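(* Let $(s_n)_n$ be a positive sequence with $s_n\to\infty$ and let $f_n:(0,\infty)\to(0,\infty)$, $n\in\mathbb{N}$, be strictly increasing functions arising from an edge-weight distribution as in the context. Suppose: (1) for every $x\ge0$, $f_n(x^{1/s_n})/f_n(1)\to x$ as $n\to\infty$; (2) there exist $\varepsilon_0>0$, $\delta_0\in(0,1]$, $n_0\in\mathbb{N}$ such that $\varepsilon_0s_n\le x\frac{d}{dx}\log f_n(x)\le s_n/\varepsilon_0$ whenever $1-\delta_0\le x\le1$ and $n\ge n_0$; (3) there exist $\varepsilon_1>0$, $n_1\in\mathbb{N}$ such that $x\frac{d}{dx}\log f_n(x)\ge\varepsilon_1s_n$ for every $x\ge1$, $n\ge n_1$. For $j\in\{1,2\}$ let $T_{\mathrm{fr}}^{(j)}$ be the freezing time and let $M^{(j)}$ be the largest weight of an invaded edge in invasion percolation on $\mathcal{T}^{(j)}$. Then $f_n^{-1}(T_{\mathrm{fr}}^{(j)})\to M^{(j)}$ in probability as $n\to\infty$, for $j=1,2$.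
   Context: Edge weights: for each $n$ there is a strictly increasing $g_n:(0,\infty)\to(0,\infty)$ and $f_n(x)=g_n(x/n)$; set $f_n(0)=\lim_{x\downarrow0}f_n(x)$ and $f_n^{-1}(y)=\sup\{x>0:f_n(x)\le y\}$ ($\sup\emptyset=0$). PWIT: $\mathcal{T}^{(1)},\mathcal{T}^{(2)}$ are two independent (vertex-disjoint) copies of the Poisson-weighted infinite tree: $\mathcal{T}^{(j)}$ has root $\emptyset_j$, each vertex $v$ has children $v1,v2,\dots$, and the weight $X_{vk}$ of the edge between $v$ and $vk$ is such that $(X_{v1},X_{v2},\dots)$ are the ordered points of a rate-1 Poisson point process on $(0,\infty)$, independently over $v$. The weights do not depend on $n$. First passage percolation on the PWIT: for $v\in\mathcal{T}^{(j)}$ let $T_v$ be the sum of $f_n(X_w)$ over all non-root vertices $w$ on the path from $\emptyset_j$ to $v$ (including $v$), $T_{\emptyset_j}=0$, and let $\mathrm{BP}_t^{(j)}=\{v\in\mathcal{T}^{(j)}:T_v\le t\}$. $\mu_n$ is the image of Lebesgue measure on $(0,\infty)$ under $f_n$, and $\lambda_n>0$ is the unique solution (for $n$ large) of $\int_0^\infty e^{-\lambda_ny}\,d\mu_n(y)=1$. Freezing times: $$T_{\mathrm{fr}}^{(j)}=\inf\Bigl\{t\ge0:\ \sum_{v\in\mathrm{BP}_t^{(j)}}\int_{t-T_v}^\infty e^{-\lambda_n(y-(t-T_v))}\,d\mu_n(y)\ge s_n\Bigr\}.$$ Invasion percolation on $\mathcal{T}^{(j)}$: $\mathrm{IP}^{(j)}(0)=\{\emptyset_j\}$,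 and $\mathrm{IP}^{(j)}(k)$ is obtained from $\mathrm{IP}^{(j)}(k-1)$ by adding the vertex $v\notin\mathrm{IP}^{(j)}(k-1)$ with parent in $\mathrm{IP}^{(j)}(k-1)$ having minimal $X_v$. $\mathrm{IP}^{(j)}(\infty)=\bigcup_k\mathrm{IP}^{(j)}(k)$ and $M^{(j)}=\sup\{X_v:v\in\mathrm{IP}^{(j)}(\infty)\setminus\{\emptyset_j\}\}$. *)

(* Defs.v *)
From HB Require Import structures.
From mathcomp Require Export all_boot all_order all_algebra.
From mathcomp Require Export all_classical all_reals all_analysis.
Export Order.TTheory GRing.Theory Num.Theory.
Export numFieldNormedType.Exports.

Set Implicit Arguments.
Unset Strict Implicit.
Unset Printing Implicit Defensive.

Local Open Scope classical_set_scope.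
Local Open Scope ring_scope.

(* Vertices of a rooted tree in Ulam-Harris notation: [::] is the root, and the
   children of v are rcons v 0, rcons v 1, ... (numbered from 0).  A weighting
   x : vertex -> R gives at v != [::] the weight of the edge joining v to its
   parent; its value at the root is never used. *)
Definition vertex := seq nat.

(* f_n(x) = g_n(x / n) for x > 0.  The value f_n(0) = lim_{x -> 0+} f_n(x) is
   also used for x < 0, which makes f_n monotone on the whole line. *)
Definition edge_fun (R : realType) (g : nat -> R -> R) (n : nat) (x : R) : R :=
  if 0 < x then g n (x / n%:R) else lim (g n (y / n%:R) @[y --> 0^'+]).

Definition positive_increasing (R : realType) (h : R -> R) : Prop :=
  (forall x, 0 < x -> 0 < h x) /\ (forall x y, 0 < x -> x < y -> h x < h y).

(* f^{-1}(y) = sup {x > 0 : f x <= y}; adjoining 0 gives sup of the empty set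
   the value 0. *)
Definition edge_fun_inv (R : realType) (f : R -> R) (y : \bar R) : \bar R :=
  ereal_sup ([set 0%E] `|`
    [set x%:E | x in [set x : R | 0 < x /\ ((f x)%:E <= y)%E]]).

Definition image_measure (R : realType) (f : R -> R) : set R -> \bar R :=
  pushforward (mrestr (@lebesgue_measure R) (measurable_itv `]0%R, +oo[)) f.

Definition malthusian (R : realType) (f : R -> R) : R :=
  xget 0 [set l : R | 0 < l /\
    (\int[image_measure f]_(y in `]0%R, +oo[) (expR (- l * y))%:E = 1)%E].

Definition birth_time (R : realType) (f : R -> R) (x : vertex -> R)
    (v : vertex) : R :=
  \sum_(1 <= i < (size v).+1) f (x (take i v)).

Definition branching_process (R : realType) (f : R -> R) (x : vertex -> R)
    (t : R) : set vertex :=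
  [set v | birth_time f x v <= t].

Definition freezing_weight (R : realType) (f : R -> R) (x : vertex -> R)
    (t : R) : \bar R :=
  (\esum_(v in branching_process f x t)
    \int[image_measure f]_(y in `[(t - birth_time f x v)%R, +oo[)
      (expR (- malthusian f * (y - (t - birth_time f x v))))%:E)%E.

Definition freezing_time (R : realType) (f : R -> R) (s : R)
    (x : vertex -> R) : \bar R :=
  ereal_inf [set t%:E | t in
    [set t : R | 0 <= t /\ (s%:E <= freezing_weight f x t)%E]].

Definition boundary (S : set vertex) : set vertex :=
  [set v | ~ S v /\ exists u k, S u /\ v = rcons u k].

(* Edge weights of the Poisson-weighted infinite tree are almost surely
   distinct, so that almost surely each step adds exactly one vertex. *)
Fixpoint invasion (R : realType) (x : vertex -> R) (k : nat) : set vertex :=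
  if k is k'.+1 then
    let S := invasion x k' in
    S `|` [set v | boundary S v /\ forall u, boundary S u -> x v <= x u]
  else [set [::]].

Definition invasion_cluster (R : realType) (x : vertex -> R) : set vertex :=
  \bigcup_k invasion x k.

Definition max_invaded_weight (R : realType) (x : vertex -> R) : \bar R :=
  ereal_sup [set (x v)%:E | v in invasion_cluster x `\ [::]].

Definition mutually_independent (R : realType) (d : measure_display)
    (Omega : measurableType d) (P : probability Omega R) (I : choiceType)
    (F : I -> set (set Omega)) : Prop :=
  forall (J : seq I) (A : I -> set Omega), uniq J ->
    (forall i, i \in J -> F i (A i)) ->
    P (\big[setI/setT]_(i <- J) A i) = (\prod_(i <- J) P (A i))%E.

Definition sigma_generated (R : realType) (d : measure_display)
    (Omega : measurableType d) (K : Type) (Y : K -> Omega -> R) :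
    set (set Omega) :=
  <<s \bigcup_k preimage_set_system setT (Y k) measurable >>.

(* The library's poisson_pmf is constantly 1 at rate 0, whereas null sets carry
   no points. *)
Definition poisson_weight (R : realType) (r : R) (m : nat) : R :=
  expR (- r) * r ^+ m / m`!%:R.

(* Y 0 <= Y 1 <= ... are the ordered points of a Poisson point process with
   Lebesgue intensity on (0, +oo): the numbers of points in disjoint Borel sets
   of finite measure are independent Poisson variables. *)
Definition ordered_poisson_points (R : realType) (d : measure_display)
    (Omega : measurableType d) (P : probability Omega R)
    (Y : nat -> Omega -> R) : Prop :=
  {ae P, forall w, forall k, 0 < Y k w /\ Y k w <= Y k.+1 w} /\
  forall (q : nat) (B : 'I_q -> set R) (m : 'I_q -> nat),
    (forall i, measurable (B i)) ->
    (forall i, B i `<=` `]0%R, +oo[) ->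
    (forall i, (lebesgue_measure (B i) < +oo)%E) ->
    trivIset setT B ->
    P [set w | forall i, counting [set k | B i (Y k w)] = (m i)%:R%:E :> \bar R] =
    (\prod_(i < q) poisson_weight (fine (lebesgue_measure (B i))) (m i))%:E.

Definition is_PWIT (R : realType) (d : measure_display)
    (Omega : measurableType d) (P : probability Omega R)
    (X : vertex -> {RV P >-> R}) : Prop :=
  (forall v, ordered_poisson_points P (fun k => X (rcons v k))) /\
  mutually_independent P
    (fun v => sigma_generated (fun k => X (rcons v k) : Omega -> R)).

Definition independent_PWITs (R : realType) (d : measure_display)
    (Omega : measurableType d) (P : probability Omega R)
    (X : 'I_2 -> vertex -> {RV P >-> R}) : Prop :=
  (forall j, is_PWIT (X j)) /\
  mutually_independent P (fun j => sigma_generated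
    (fun vk : vertex * nat => X j (rcons vk.1 vk.2) : Omega -> R)).

(* The outer measure P^* agrees with P on events, and keeps the definition
   meaningful for sets not known to be events.  The library has
   +oo - +oo = -oo, so Y and Z both +oo are not counted as close. *)
Definition cvg_in_probability (R : realType) (d : measure_display)
    (Omega : measurableType d) (P : probability Omega R)
    (Y : nat -> Omega -> \bar R) (Z : Omega -> \bar R) : Prop :=
  forall eps : R, 0 < eps ->
    (P^*)%mu [set w | (eps%:E < `|Y n w - Z w|)%E] @[n --> \oo] --> 0%E.

(* Main.v *)
(* Write Z_k(r) for the size of generation k of the subtree of the root formed by
   the edges of weight at most r.  This is a Poisson(r) Galton-Watson process, and
   M < r forces Z_k(r) > 0 for all k while M > r forces Z_k(r) = 0 for some k.

   If M > r + delta, the finite subtree at level r + delta contains every vertex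
   born before time f_n(r), each of them has a bounded discounted weight, and
   s_n -> oo: hence T_fr >= f_n(r).

   If M < r with r > 1, the subtree at level r survives.  Follow it for about
   s_n ^ 2 generations, and then for l generations only the edges of weight at most
   exp(1 / s_n), where f_n is still of order f_n(1).  The iterates of
   q |-> 1 - exp(- r q) show that with high probability this leaves at least
   exp(l / s_n) vertices.  As f_n(r + delta) / f_n(r) is exponentially large in s_n,
   there is time for l = s_n (f_n(r) / f_n(1) + s_n) such generations, and then some
   time window of length of order f_n(1) contains many more than s_n ^ 2 births.
   Each of them has weight at least of order 1 / s_n, since lambda_n f_n(1) is
   bounded: hence T_fr <= f_n(r + delta).

   The two bounds are combined along a finite grid of values of r. *)

Require Import Defs.
From mathcomp Require Import measurable_realfun ring lra.

Set Implicit Arguments.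
Unset Strict Implicit.
Unset Printing Implicit Defensive.

Local Open Scope classical_set_scope.
Local Open Scope ring_scope.

(** * Generations of a weighted tree *)

(** Nothing bounds [f r / f 1] from above for [r > 1], so the number of windows of length of order
    [f 1] is not controlled by [s_n] alone. This is why the ratio enters the number [l] of nearly
    critical generations: with [A = f r / f 1] and [S = s_n] these cost time of order
    [S * (A + S) * f 1], at most a multiple of [S ^ 2 * f r], and yield about [exp (A + S)]
    vertices, which beats [A] times any power of [S]. Polynomial losses are harmless, because
    [f (r + delta) / f r] is exponential in [S]; so [S ^ 2] generations are spent where a
    logarithmic number would do, and Bernoulli's inequality replaces finer estimates. Probability
    enters only through generating functions of generation sizes at deterministic levels. The
    freezing time and [M] are tied to these sizes by inclusions valid on every locally finite tree,
    so their events are covered by measurable ones. Levels [r <= 1] need no upper bound on the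
    freezing time, since [M >= 1] almost surely: the Poisson(1) tree dies out. *)

Definition children (v : vertex) (m : nat) : seq vertex :=
  [seq rcons v k | k <- iota 0 m].

(* The junk value 0 is taken when no child has weight above the level; under
   the Poisson law this has probability 0. *)
Definition degree (R : realType) (x : vertex -> R) (r : R) (v : vertex) : nat :=
  if pselect (exists k, r < x (rcons v k)) is left h then ex_minn h else 0%N.

Fixpoint generation (R : realType) (x : vertex -> R) (th : nat -> R) (i : nat) :
    seq vertex :=
  if i is j.+1 then
    flatten [seq children v (degree x (th j) v) | v <- generation x th j]
  else [:: [::]].

Section generation_theory.
Context {R : realType}.
Implicit Types (x : vertex -> R) (th : nat -> R) (v : vertex).

Lemma degreeP x r v m : degree x r v = m <->
  (r < x (rcons v m) /\ forall k, (k < m)%N -> x (rcons v k) <= r) \/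
  (m = 0%N /\ forall k, x (rcons v k) <= r).
Proof.
rewrite /degree; case: pselect => [h|h].
  case: ex_minnP => n rn minn; split=> [<-|[[rm hm]|[_ h']]].
  - left; split=> // k kn; rewrite leNgt; apply/negP => /minn.
    by rewrite leqNgt kn.
  - have nm := minn _ rm; apply/eqP; rewrite eqn_leq nm /= leqNgt.
    by apply/negP => /hm; rewrite leNgt rn.
  - by case: h => k; rewrite ltNge h'.
split=> [<-|[[rm _]|[-> _]]] //.
  by right; split=> // k; rewrite leNgt; apply/negP => rk; apply: h; exists k.
by case: h; exists m.
Qed.

Lemma size_children v m : size (children v m) = m.
Proof. by rewrite size_map size_iota. Qed.

Lemma size_generationS x th i : size (generation x th i.+1) =
  (\sum_(v <- generation x th i) degree x (th i) v)%N.
Proof.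
rewrite /= size_flatten /shape -map_comp sumnE big_map.
by apply: eq_bigr => v _; rewrite /= size_children.
Qed.

Lemma mem_generationS x th i u : u \in generation x th i.+1 <->
  exists v k, [/\ v \in generation x th i, (k < degree x (th i) v)%N &
    u = rcons v k].
Proof.
split=> [/= /flattenP[s /mapP[v vg ->{s}] /mapP[k]]|].
  by rewrite mem_iota /= add0n => kd ->; exists v, k.
move=> [v [k [vg kd ->]]] /=; apply/flattenP.
exists (children v (degree x (th i) v)); first by apply/mapP; exists v.
by apply/mapP; exists k => //; rewrite mem_iota.
Qed.

Lemma mem_generation_size x th i v : v \in generation x th i -> size v = i.
Proof.
elim: i v => [|i IH] v; first by rewrite inE => /eqP ->.
by move=> /mem_generationS[u [k [/IH ui _ ->]]]; rewrite size_rcons ui.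
Qed.

Lemma uniq_generation x th i : uniq (generation x th i).
Proof.
elim: i => [//|i IH] /=.
elim: (generation x th i) IH => [//|v l IHl] /= /andP[vl ul].
rewrite cat_uniq (IHl ul) andbT map_inj_uniq ?iota_uniq//; last first.
  by move=> a b /rcons_inj[].
apply/hasPn => u /flattenP[s /mapP[w wl ->{s}] /mapP[k _ ->{u}]].
apply/negP => /mapP[j _ /rcons_inj[wv _]].
by rewrite -wv wl in vl.
Qed.

Lemma eq_generation x th th' i : (forall j, (j < i)%N -> th j = th' j) ->
  generation x th i = generation x th' i.
Proof.
elim: i => [//|i IH] h /=; rewrite (IH (fun j ji => h j (ltnW ji))).
by rewrite h.
Qed.

Lemma generation_nil x th i k : (i <= k)%N ->
  size (generation x th i) = 0%N -> size (generation x th k) = 0%N.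
Proof.
move=> /subnKC <- h; elim: (k - i)%N => [|j IH]; first by rewrite addn0.
by rewrite addnS size_generationS (size0nil IH) big_nil.
Qed.

End generation_theory.

(** Measurability for the discrete sigma-algebra on [S]. Degrees and generations are countable data:
    singletons are enough, and any function of them stays measurable. *)
Definition countably_measurable (d : measure_display) (T : measurableType d)
  (S : choiceType) (Y : T -> S) := forall A : set S, measurable (Y @^-1` A).

Section countably_measurable_theory.
Context d (T : measurableType d).

Lemma countably_measurableP (S : countType) (Y : T -> S) :
  (forall t, measurable [set w | Y w = t]) -> countably_measurable Y.
Proof.
move=> mY A.
rewrite (_ : Y @^-1` A = \bigcup_(t in A) [set w | Y w = t]).
  rewrite bigcup_mkcond; apply: countable_bigcupT_measurable => [|t];
    first exact: countableP.
  by case: ifP.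
apply/seteqP; split=> w /=; first by move=> Aw; exists (Y w).
by move=> [t At Yt]; rewrite /preimage /= Yt.
Qed.

Lemma countably_measurable_comp (S S' : choiceType) (h : S -> S') (Y : T -> S) :
  countably_measurable Y -> countably_measurable (h \o Y).
Proof. by move=> mY A; exact: (mY (h @^-1` A)). Qed.

Lemma countably_measurable_pair (S S' : countType) (Y : T -> S) (Z : T -> S') :
  countably_measurable Y -> countably_measurable Z ->
  countably_measurable (fun w => (Y w, Z w)).
Proof.
move=> mY mZ; apply: countably_measurableP => -[a b].
rewrite (_ : [set _ | _] = Y @^-1` [set a] `&` Z @^-1` [set b]).
  exact: measurableI.
by apply/seteqP; split=> w /= => [[-> ->]|[-> ->]].
Qed.

Lemma measurable_const_prop (p : Prop) : measurable [set _ : T | p].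
Proof.
have [hp|hp] := pselect p.
  by rewrite (_ : [set _ | _] = setT)//; apply/seteqP; split.
by rewrite (_ : [set _ | _] = set0)//; apply/seteqP; split.
Qed.

Lemma countably_measurable_seq (U : Type) (S : countType) (l : seq U) (Y : U ->
  T -> S) :
  (forall u, countably_measurable (Y u)) ->
  countably_measurable (fun w => [seq Y u w | u <- l]).
Proof.
move=> mY; elim: l => [|u l IH] /= A.
  by rewrite (_ : _ @^-1` _ = [set _ | A [::]])//; exact: measurable_const_prop.
exact: (countably_measurable_comp (fun p => p.1 :: p.2)
  (countably_measurable_pair (mY u) IH) A).
Qed.

(** Splitting along the countably many values of [Y] replaces a random index by a fixed one; this is
    how the offspring of a random list of vertices is handled. *)
Lemma countably_measurable_bind (S : countType) (S' : choiceType) (Y : T ->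
  S) (Z : S -> T -> S') :
  countably_measurable Y -> (forall t, countably_measurable (Z t)) ->
  countably_measurable (fun w => Z (Y w) w).
Proof.
move=> mY mZ A.
rewrite (_ : _ @^-1` _ = \bigcup_(t in setT) (Y @^-1` [set t] `&` Z t @^-1` A)).
  by apply: countable_bigcupT_measurable => [|t]; first exact: countableP;
    apply: measurableI; [exact: mY|exact: mZ].
apply/seteqP; split=> w /=; first by move=> Aw; exists (Y w).
by move=> [t _ [Yt]]; rewrite /preimage /= Yt.
Qed.

End countably_measurable_theory.

Section partition.
Context d (T : measurableType d) (R : realType).
Variables (Y : T -> nat) (mY : countably_measurable Y).
Local Open Scope ereal_scope.

Lemma partition_bigcup (A : set T) : A = \bigcup_n (A `&` [set w | Y w = n]).
Proof.
by apply/seteqP; split=> w; [move=> Aw; exists (Y w)|move=> [n _ []]].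
Qed.

Lemma partition_trivIset (A : set T) :
  trivIset setT (fun n => A `&` [set w | Y w = n]).
Proof. by move=> i j _ _ [w [[_ <-] [_ <-]]]. Qed.

Lemma measurable_partition (A : set T) n :
  measurable A -> measurable (A `&` [set w | Y w = n]).
Proof. by move=> mA; apply: measurableI => //; exact: (mY [set n]). Qed.

Lemma measure_partition (mu : {measure set T -> \bar R}) (A : set T) :
  measurable A -> mu A = \sum_(n <oo) mu (A `&` [set w | Y w = n]).
Proof.
move=> mA; rewrite [in LHS](partition_bigcup A) measure_semi_bigcup//.
- by move=> n; exact: measurable_partition.
- exact: partition_trivIset.
- by rewrite -partition_bigcup.
Qed.

Lemma integral_partition (mu : {measure set T -> \bar R}) (A : set T)
    (f : T -> \bar R) : measurable A -> measurable_fun A f ->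
  (forall w, 0 <= f w) ->
  \int[mu]_(w in A) f w =
  \sum_(n <oo) \int[mu]_(w in A `&` [set w | Y w = n]) f w.
Proof.
move=> mA mf f0; rewrite [in LHS](partition_bigcup A) ge0_integral_bigcup//.
- by move=> n; exact: measurable_partition.
- by rewrite -partition_bigcup.
- exact: partition_trivIset.
Qed.

End partition.

Section measurable_generation.
Context d (T : measurableType d) (R : realType) (X : T -> vertex -> R).

Lemma measurable_le_set v r : measurable_fun setT (fun w => X w v) ->
  measurable [set w | X w v <= r].
Proof.
move=> mX; rewrite -[X in measurable X]setTI.
exact: (measurable_fun_le measurableT mX (measurable_cst r)).
Qed.

Lemma measurable_degree_set (r : R) (v : vertex) (m : nat) :
  (forall k, measurable_fun setT (fun w => X w (rcons v k))) ->
  measurable [set w | degree (X w) r v = m].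
Proof.
move=> mX; have mle k := measurable_le_set r (mX k).
rewrite (_ : [set w | _] =
  (~` [set w | X w (rcons v m) <= r] `&`
     \bigcap_(k in `I_m) [set w | X w (rcons v k) <= r]) `|`
  ([set w | m = 0%N] `&` \bigcap_k [set w | X w (rcons v k) <= r])).
  apply: measurableU; apply: measurableI.
  - exact: measurableC.
  - by rewrite bigcap_mkcond; apply: bigcapT_measurable => k;
    case: ifP => // _; exact: measurableT.
  - exact: measurable_const_prop.
  - exact: bigcapT_measurable.
apply/seteqP; split=> w /=.
  move/degreeP => [[rm h]|[-> h]].
    by left; split=> //; apply/negP; rewrite -ltNge.
  by right; split=> // k _; exact: h.
move=> [[rm h]|[m0 h]]; apply/degreeP.
  by left; split=> //; rewrite ltNge; apply/negP.
by right; split=> // k; exact: h.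
Qed.

Hypothesis mX : forall v, measurable_fun setT (fun w => X w v).

Lemma countably_measurable_degree r v :
  countably_measurable (fun w => degree (X w) r v).
Proof. by apply: countably_measurableP => m; exact: measurable_degree_set. Qed.

Lemma countably_measurable_generation th i :
  countably_measurable (fun w => generation (X w) th i).
Proof.
elim: i => [|i IH] A /=; first exact: measurable_const_prop.
have := countably_measurable_bind IH (Z := fun l w =>
  flatten [seq children v (degree (X w) (th i) v) | v <- l]).
apply => l.
have ml : countably_measurable (fun w =>
    [seq children v (degree (X w) (th i) v) | v <- l]).
  apply: countably_measurable_seq => v.
  have mv := countably_measurable_degree (th i) v.
  have := countably_measurable_comp (children v) mv.
  exact.
exact: (countably_measurable_comp flatten ml).
Qed.

End measurable_generation.

(** * Poisson points and offspring numbers *)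

Section null_sets.
Context d (T : measurableType d) (R : realType) (mu : {measure set T ->
  \bar R}).
Local Open Scope ereal_scope.

Lemma measure_setD_null (A N : set T) : measurable A -> measurable N ->
  mu N = 0 -> mu A = mu (A `\` N).
Proof.
move=> mA mN N0; rewrite (measureDI mu mA mN) [X in _ + X](_ : _ = 0) ?adde0//.
apply/eqP; rewrite eq_le measure_ge0 andbT -N0.
by apply: le_measure => //; apply/mem_set => //; exact: measurableI.
Qed.

Lemma measure_eq_ae (A B : set T) : measurable A -> measurable B ->
  {ae mu, forall w, A w <-> B w} -> mu A = mu B.
Proof.
move=> mA mB [N [mN N0 hN]].
rewrite (measure_setD_null mA mN N0) (measure_setD_null mB mN N0).
have AB w : ~ N w -> A w <-> B w.
  by move=> Nw; apply: contrapT => h; apply: Nw; exact: hN.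
by congr (mu _); apply/seteqP; split=> w [/= Aw Nw]; split=> //;
  apply/(AB _ Nw).
Qed.

End null_sets.

Section poisson.
Context {R : realType}.

Lemma poisson_weight_ge0 (r : R) m : 0 <= r -> 0 <= poisson_weight r m.
Proof. by move=> r0; rewrite /poisson_weight divr_ge0 ?mulr_ge0 ?exprn_ge0
  ?expR_ge0. Qed.

Lemma poisson_weight_pgf (r q : R) : 0 <= r -> 0 <= q ->
  (\sum_(m <oo) (q ^+ m * poisson_weight r m)%:E = (expR (- (r * (1 -
    q))))%:E)%E.
Proof.
move=> r0 q0; rewrite [RHS](_ : _ = (expR (- r))%:E * (expR (q * r))%:E)%E;
  last first.
  by rewrite -EFinM -expRD; congr (expR _)%:E; ring.
under eq_eseriesr => n _.
  rewrite (_ : _ * _ = expR (- r) * ((q * r) ^+ n / n`!%:R)); last first.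
    by rewrite /poisson_weight exprMn; ring.
  rewrite EFinM; over.
rewrite /= nneseriesZl/=; last first.
  by move=> n _; rewrite lee_fin divr_ge0// exprn_ge0// mulr_ge0.
congr *%E; rewrite expRE -EFin_lim; last first.
  rewrite /pseries/=; under eq_fun do rewrite mulrC.
  exact: is_cvg_series_exp_coeff.
apply/congr_lim/funext => n/=; rewrite /pseries/= /series/= -sumEFin//.
by under eq_bigr do rewrite mulrC.
Qed.

Lemma poisson_weight_sum (r : R) : 0 <= r ->
  (\sum_(m <oo) (poisson_weight r m)%:E = 1)%E.
Proof.
move=> r0; have := poisson_weight_pgf r0 (ler01 : 0 <= 1 :> R).
rewrite subrr mulr0 oppr0 expR0 => <-; apply: eq_eseriesr => m _.
by rewrite expr1n mul1r.
Qed.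

End poisson.

Section counting_points.
Context {R : realType}.

(** For positive nondecreasing [y] this says that []0, r]] holds exactly [m] points. It is also the
    first case of [degreeP], so it links the counting measure to [degree]. *)
Definition counts_to (y : nat -> R) (r : R) (m : nat) :=
  r < y m /\ forall k, (k < m)%N -> y k <= r.

Lemma countingE (y : nat -> R) (r : R) m :
  (forall k, 0 < y k /\ y k <= y k.+1) ->
  counting [set k | `]0, r]%classic (y k)] = m%:R%:E :> \bar R <->
  counts_to y r m.
Proof.
move=> hy; have ndy : forall i j, (i <= j)%N -> y i <= y j.
  move=> i j /subnKC <-; elim: (j - i)%N => [|l IH]; first by rewrite addn0.
  by rewrite addnS (le_trans IH)//; have [] := hy (i + l)%N.
have step k : counts_to y r k ->
    counting [set k | `]0, r]%classic (y k)] = k%:R%:E :> \bar R.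
  move=> [rk hk].
  rewrite (_ : [set k | _] = `I_k); last first.
    apply/seteqP; split=> l /=; rewrite in_itv /= (hy l).1 /=.
      by move=> lr; rewrite ltnNge; apply/negP => /ndy kl;
        move: (lt_le_trans rk kl); rewrite ltNge lr.
    exact: hk.
  rewrite /counting asboolT; last exact: finite_II.
  by rewrite (card_fset_set (card_eqxx _)).
split=> [|/step //].
rewrite /counting; case: asboolP => // finS [] cardS.
have [k hk] : exists k, counts_to y r k.
  have [h|/forallNP h] := pselect (exists k, r < y k).
    have [k rk mk] := ex_minnP h; exists k; split=> // l lk.
    by rewrite leNgt; apply/negP => /mk; rewrite leqNgt lk.
  exfalso; apply: infinite_nat; apply: sub_finite_set finS => k _ /=.
  by rewrite in_itv /= (hy k).1 /= leNgt; apply/negP/h.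
have := step _ hk; rewrite /counting asboolT// => -[].
by rewrite cardS => /eqP; rewrite eqr_nat => /eqP ->.
Qed.

Lemma measurable_counting d (T : measurableType d) (Y : nat -> T -> R)
    (B : set R) m : measurable B -> (forall k, measurable_fun setT (Y k)) ->
  measurable [set w | counting [set k | B (Y k w)] = m%:R%:E :> \bar R].
Proof.
move=> mB mY.
(* Finite index sets are listed by the countable type [seq nat], so the event is a countable union
   of conditions on individual points. *)
pose E (s : seq nat) := \bigcap_k [set w | B (Y k w) <-> k \in s].
rewrite (_ : [set w | _] = \bigcup_(s in [set s : seq nat |
    counting [set` s] = m%:R%:E :> \bar R]) E s).
  rewrite bigcup_mkcond; apply: countable_bigcupT_measurable => [|s].
    exact: countableP.
  case: ifP => // _; apply: bigcapT_measurable => k.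
  have mBk : measurable (Y k @^-1` B) by rewrite -[X in measurable X]setTI;
    exact: mY.
  case: (k \in s).
    rewrite (_ : [set w | _] = Y k @^-1` B)//; apply/seteqP.
    by split=> w /=; [case=> _; exact|move=> h; split].
  rewrite (_ : [set w | _] = ~` (Y k @^-1` B)); first exact: measurableC.
  by apply/seteqP; split=> w /=; [move=> [h _] /h|move=> h; split].
apply/seteqP; split=> w /=; last first.
  move=> [s /= <- Es]; congr counting.
  by apply/seteqP; split=> k /=; have := Es k I; rewrite /=; tauto.
move=> cw; have [s sE] : exists s : seq nat, [set k | B (Y k w)] = [set` s].
  by apply/finite_seqP; move: cw; rewrite /counting; case: asboolP.
exists s; first by rewrite /= -sE.
by move=> k _; rewrite /= (_ : B (Y k w) = [set` s] k)// -sE.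
Qed.

End counting_points.

Section degree_law.
Context d (T : measurableType d) (R : realType) (P : probability T R).
Context (Y : nat -> T -> R) (mY : forall k, measurable_fun setT (Y k)).
Hypothesis hY : ordered_poisson_points P Y.
Local Open Scope ereal_scope.

Lemma measurable_counts_to r m :
  measurable [set w | counts_to (fun k => Y k w) r m].
Proof.
have mle k : measurable [set w | (Y k w <= r)%R].
  exact: (@measurable_le_set _ _ _ (fun w _ => Y k w) [::]).
rewrite (_ : [set w | _] = ~` [set w | (Y m w <= r)%R] `&`
    \bigcap_(k in `I_m) [set w | (Y k w <= r)%R]).
  apply: measurableI; first exact: measurableC.
  rewrite bigcap_mkcond; apply: bigcapT_measurable => k.
  by case: ifP => // _; exact: measurableT.
apply/seteqP; split=> w /= [rm hr]; split=> //.
  by apply/negP; rewrite -ltNge.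
by rewrite ltNge; apply/negP.
Qed.

Lemma probability_counts_to (r : R) m : (0 < r)%R ->
  P [set w | counts_to (fun k => Y k w) r m] = (poisson_weight r m)%:E.
Proof.
move=> r0; have [ordY /(_ 1%N (fun _ => `]0%R, r]%classic) (fun _ => m))] := hY.
have lr : lebesgue_measure `]0%R, r]%classic = r%:E :> \bar R.
  by rewrite lebesgue_measure_itv /= lte_fin r0 -EFinB subr0.
rewrite big_ord1 lr /= => <-.
- apply: measure_eq_ae; first exact: measurable_counts_to.
    rewrite (_ : [set w | _] = [set w | counting
       [set k | `]0%R, r]%classic (Y k w)] = m%:R%:E :> \bar R]).
      exact: measurable_counting.
    by apply/seteqP; split=> w /= h; [exact: (h ord0)|move=> _; exact: h].
  apply: filterS ordY => w ow; rewrite /= -(countingE _ _ ow).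
  by split=> [h _|h]; [exact: h|exact: (h ord0)].
- by move=> _; exact: measurable_itv.
- by move=> _ z /=; rewrite !in_itv/= andbT => /andP[].
- by rewrite ltry.
- by move=> i j _ _ _; rewrite !ord1.
Qed.

(** The Poisson weights sum to 1, so no probability is left for infinitely many points in []0, r]].
    This yields local finiteness of the tree. *)
Lemma ae_exists_counts_to (r : R) : (0 < r)%R ->
  {ae P, forall w, exists m, counts_to (fun k => Y k w) r m}.
Proof.
move=> r0; pose E m := [set w | counts_to (fun k => Y k w) r m].
have mE m : measurable (E m) by exact: measurable_counts_to.
have PE : P (\bigcup_m E m) = 1.
  rewrite measure_bigcup//.
    rewrite -(poisson_weight_sum (ltW r0)) [LHS]eseries_mkcond.
    apply: eq_eseriesr => m _; rewrite in_setT.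
    exact: probability_counts_to.
  move=> i j _ _ [w [[ri hi] [rj hj]]]; apply/eqP; rewrite eqn_leq.
  apply/andP; split; rewrite leqNgt; apply/negP.
    by move=> /hi; rewrite leNgt rj.
  by move=> /hj; rewrite leNgt ri.
have mU : measurable (\bigcup_m E m) by exact: bigcupT_measurable.
exists (~` \bigcup_m E m); split.
- exact: measurableC.
- by rewrite probability_setC// PE subee.
- by apply: subsetC => w [m _ Em]; exists m.
Qed.

End degree_law.

Section degree_law_tree.
Context d (T : measurableType d) (R : realType) (P : probability T R).
Context (X : vertex -> {RV P >-> R}) (v : vertex).
Hypothesis hX : ordered_poisson_points P (fun k => X (rcons v k)).

Lemma probability_degree (r : R) m : 0 < r ->
  P [set w | degree (X^~ w) r v = m] = (poisson_weight r m)%:E.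
Proof.
move=> r0; rewrite -(probability_counts_to _ hX)//.
apply: measure_eq_ae; first exact: measurable_degree_set.
  exact: measurable_counts_to.
apply: filterS (ae_exists_counts_to _ hX r0) => // w [k [rk hk]] /=.
split=> [/degreeP|cm]; last by apply/degreeP; left.
by case=> // -[_ /(_ k)]; rewrite leNgt rk.
Qed.

End degree_law_tree.

(** * Generating functions of the generation sizes *)

Section independent_beyond.
Context d (T : measurableType d) (R : realType) (P : probability T R).
Variable F : vertex -> set (set T).
Hypotheses (mF : forall v A, F v A -> measurable A)
  (indF : mutually_independent P F).
Local Open Scope ereal_scope.

(* The event [generation i = l] has this property: it is a countable disjoint
   union, over the finite trees ending in [l], of finite intersections of
   offspring events.  So the product rule is all that is used of independence.
     *)
Definition independent_beyond (i : nat) (A : set T) : Prop :=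
  measurable A /\
  forall (J : seq vertex) (B : vertex -> set T), uniq J ->
    (forall v, v \in J -> (i <= size v)%N) ->
    (forall v, v \in J -> F v (B v)) ->
    P (A `&` \big[setI/setT]_(v <- J) B v) = P A * \prod_(v <- J) P (B v).

Lemma measurable_bigsetI (J : seq vertex) (B : vertex -> set T) :
  (forall v, v \in J -> F v (B v)) -> measurable (\big[setI/setT]_(v <- J) B v).
Proof.
move=> FB; rewrite big_seq; elim/big_ind: _ => //; first exact: measurableI.
by move=> v /FB /mF.
Qed.

Lemma independent_beyondT : independent_beyond 0 setT.
Proof.
split=> // J B uJ _ FB; rewrite setTI probability_setT mul1e.
exact: indF.
Qed.

Lemma independent_beyond0 i : independent_beyond i set0.
Proof. by split=> // J B _ _ _; rewrite set0I measure0 mul0e. Qed.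

(** Vertices of length [i] and longer ones form one duplicate-free family, to which the product rule
    for [A] applies; applying it again to [l] alone regroups the factors. *)
Lemma independent_beyondS i A (l : seq vertex) (B : vertex -> set T) :
  independent_beyond i A -> uniq l -> (forall v, v \in l -> size v = i) ->
  (forall v, v \in l -> F v (B v)) ->
  independent_beyond i.+1 (A `&` \big[setI/setT]_(v <- l) B v).
Proof.
move=> [mA iA] ul li FB; split; first exact/measurableI/measurable_bigsetI.
move=> J C uJ Ji FC.
pose D v := if v \in l then B v else C v.
have lJ v : v \in J -> (v \in l) = false.
  by move=> /Ji iv; apply/negP => /li vi; rewrite vi ltnn in iv.
have Dl : \big[setI/setT]_(v <- l) B v = \big[setI/setT]_(v <- l) D v.
  by apply: eq_big_seq => v vl; rewrite /D vl.
have DJ : \big[setI/setT]_(v <- J) C v = \big[setI/setT]_(v <- J) D v.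
  by apply: eq_big_seq => v vJ; rewrite /D lJ.
rewrite -setIA Dl DJ -big_cat /= iA; last 3 first.
- by rewrite cat_uniq ul uJ andbT; apply/hasPn => v /lJ /= ->.
- by move=> v; rewrite mem_cat => /orP[/li -> //|/Ji /ltnW].
- by move=> v; rewrite mem_cat /D; case: (boolP (v \in l)) => [/FB//|_ /FC].
rewrite iA; last 3 first.
- exact: ul.
- by move=> v /li ->.
- by move=> v vl; rewrite /D vl; exact: FB.
rewrite big_cat /= muleA; congr (_ * _).
by apply: eq_big_seq => v vJ; rewrite /D lJ.
Qed.

Lemma independent_beyond_partition i A (Y : T -> nat) : measurable A ->
  countably_measurable Y ->
  (forall n, independent_beyond i (A `&` [set w | Y w = n])) ->
  independent_beyond i A.
Proof.
move=> mA mY iA; split=> // J B uJ Ji FB.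
rewrite (measure_partition mY P (measurableI _ _ mA (measurable_bigsetI FB))).
rewrite (measure_partition mY P mA) muleC.
have finB : \prod_(v <- J) P (B v) \is a fin_num.
  rewrite big_seq; apply/prode_fin_num => v vJ.
  by apply: fin_num_measure; exact: mF (FB _ vJ).
rewrite -(fineK finB) -nneseriesZl; last by move=> n _; exact: measure_ge0.
apply: eq_eseriesr => n _; have [_ /(_ J B uJ Ji FB) h] := iA n.
by rewrite setIAC fineK// muleC; exact: h.
Qed.

End independent_beyond.

Section generation_law.
Context d (T : measurableType d) (R : realType) (P : probability T R).
Context (X : vertex -> {RV P >-> R}).
Hypothesis hX : is_PWIT X.
Variable th : nat -> R.
Hypothesis th_gt0 : forall i, 0 < th i.
Local Open Scope ereal_scope.

Let F v := sigma_generated (fun k => X (rcons v k) : T -> R).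

Lemma sigma_generated_measurable (K : Type) (Y : K -> {RV P >-> R}) A :
  sigma_generated (fun k => Y k : T -> R) A -> measurable A.
Proof.
apply: smallest_sub; first exact: sigma_algebra_measurable.
by move=> _ [k _ [B mB <-]]; exact: measurable_funPT.
Qed.

(** [degree] is measurable for any sigma-algebra that makes the weights of the children measurable,
    so [measurable_degree_set] is applied on the space carrying the generated one. *)
Lemma sigma_generated_degree r v m : F v [set w | degree (X^~ w) r v = m].
Proof.
set G := \bigcup_k preimage_set_system setT (X (rcons v k) : T -> R) measurable.
apply: (@measurable_degree_set _ (g_sigma_algebraType G) R (fun w u => X u w)).
move=> k _ B mB; apply: sub_sigma_algebra; exists k => //; by exists B.
Qed.

Lemma generation_independent_beyond i l :
  independent_beyond P F i [set w | generation (X^~ w) th i = l].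
Proof.
have mF v A : F v A -> measurable A by exact: sigma_generated_measurable.
have mgen j : countably_measurable (fun w => generation (X^~ w) th j).
  exact: (countably_measurable_generation (X := fun w u => X u w)).
have mdeg r v : countably_measurable (fun w => degree (X^~ w) r v).
  exact: (countably_measurable_degree (X := fun w u => X u w)).
elim: i l => [|i IH] l.
  have [->|l0] := eqVneq l [:: [::]].
    rewrite (_ : [set w | _] = setT); last by apply/seteqP; split.
    by apply: independent_beyondT; exact: hX.2.
  rewrite (_ : [set w | _] = set0); first exact: independent_beyond0.
  by apply/seteqP; split=> w //= h; rewrite h eqxx in l0.
(* Generation [i] together with its list of degrees determines generation [i.+1]; the code of the
   pair as a natural number indexes the partition. *)
pose Y w := pickle (generation (X^~ w) th i,
  [seq degree (X^~ w) (th i) v | v <- generation (X^~ w) th i]).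
have mY : countably_measurable Y.
  apply: (countably_measurable_comp pickle).
  apply: countably_measurable_pair => //.
  apply: (countably_measurable_bind (mgen i)
    (Z := fun l w => [seq degree (X^~ w) (th i) v | v <- l])) => l'.
  by apply: countably_measurable_seq => v; exact: mdeg.
apply: (independent_beyond_partition mF _ mY) => [|n].
  exact: (mgen i.+1 [set l]).
have [->|/set0P[w0 [/= gl Yn]]] := eqVneq ([set w | generation (X^~ w) th i.+1 =
  l]
    `&` [set w | Y w = n]) set0; first exact: independent_beyond0.
(* A point [w0] of a nonempty cell supplies the list and the degrees, which turns the cell into a
   finite intersection covered by [independent_beyondS]. *)
set l0 := generation (X^~ w0) th i.
rewrite (_ : _ `&` _ = [set w | generation (X^~ w) th i = l0] `&`
  \big[setI/setT]_(v <- l0)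
    [set w | degree (X^~ w) (th i) v = degree (X^~ w0) (th i) v]).
  apply: independent_beyondS => //.
  - exact: uniq_generation.
  - by move=> v; exact: mem_generation_size.
  - by move=> v _; exact: sigma_generated_degree.
apply/seteqP; split=> w /=.
  move=> [_]; rewrite -Yn => /(pcan_inj pickleK) [gw dw]; split=> //.
  rewrite -bigcap_seq => v /= vl; move: dw; rewrite gw => /eq_in_map; exact.
move=> [gw]; rewrite -bigcap_seq /= => dw.
rewrite -Yn -gl /Y /= gw; split; last first.
  by congr pickle; congr pair; apply/eq_in_map => v /dw.
by congr flatten; apply/eq_in_map => v /dw /= ->.
Qed.

(** Induction on [l], partitioning by the degree [n] of the head: intersecting [A] with this event
    keeps the product rule for the tail, and the sum over [n] is one Poisson generating function. *)
Lemma integral_offspring_pgf (l : seq vertex) (r q : R) (A : set T) :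
  (0 < r)%R -> (0 <= q)%R -> uniq l -> measurable A ->
  (forall B : vertex -> set T, (forall v, v \in l -> F v (B v)) ->
    P (A `&` \big[setI/setT]_(v <- l) B v) = P A * \prod_(v <- l) P (B v)) ->
  \int[P]_(w in A) (q ^+ (\sum_(v <- l) degree (X^~ w) r v))%:E =
  P A * ((expR (- (r * (1 - q)))) ^+ size l)%:E.
Proof.
move=> r0 q0.
have mdeg v : countably_measurable (fun w => degree (X^~ w) r v).
  exact: (countably_measurable_degree (X := fun w u => X u w)).
have msum s : countably_measurable
    (fun w => (\sum_(v <- s) degree (X^~ w) r v)%N).
  rewrite [X in countably_measurable X](_ : _ =
    sumn \o (fun w => [seq degree (X^~ w) r v | v <- s])); last first.
    by apply/funext => w /=; rewrite sumnE big_map.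
  by apply: countably_measurable_comp; exact: countably_measurable_seq.
have mint s (E : set T) : measurable E -> measurable_fun E
    (fun w => (q ^+ (\sum_(v <- s) degree (X^~ w) r v)%N)%:E).
  move=> mE; apply/measurable_EFinP.
  apply: (measurableT_comp (f := fun n : nat => (q ^+ n)%R)) => //.
  by move=> _ B mB; apply: measurableI => //; exact: (msum s B).
elim: l A => [|v l IH] A; first move=> _ mA _.
  under eq_integral do rewrite big_nil expr0.
  by rewrite integral_cst// mul1e mule1.
move=> /= /andP[vl ul] mA hA.
rewrite (integral_partition (mdeg v))//; last 2 first.
- exact: (mint (v :: l)).
- by move=> w; rewrite lee_fin exprn_ge0.
rewrite (_ : P A * _ = \sum_(n <oo) (P A * (expR (- (r * (1 - q))) ^+ size
  l)%:E) *
   (q ^+ n * poisson_weight r n)%:E); last first.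
  have cfin : P A * (expR (- (r * (1 - q))) ^+ size l)%:E \is a fin_num.
    by rewrite fin_numM ?fin_num_measure.
  rewrite -(fineK cfin) nneseriesZl; last first.
    by move=> n _; rewrite lee_fin mulr_ge0 ?exprn_ge0// poisson_weight_ge0//
      ltW.
  rewrite poisson_weight_pgf//; last exact: ltW.
  by rewrite (fineK cfin) exprSr EFinM muleA.
apply: eq_eseriesr => n _.
have mAn : measurable (A `&` [set w | degree (X^~ w) r v = n]).
  exact: measurable_partition.
have PAn : P (A `&` [set w | degree (X^~ w) r v = n]) =
    P A * (poisson_weight r n)%:E.
  have := hA (fun u => if u == v then [set w | degree (X^~ w) r v = n] else
    setT).
  rewrite !big_cons eqxx big_seq big1 ?setIT; last first.
    by move=> u ul'; case: eqP => // uv; rewrite -uv ul' in vl.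
  rewrite big_seq big1 ?mule1; last first.
    move=> u ul'; case: eqP => [uv|_]; first by rewrite -uv ul' in vl.
    by rewrite probability_setT.
  move=> ->.
    by rewrite probability_degree//; exact: hX.1.
  move=> u _; case: eqP => [->|_]; first exact: sigma_generated_degree.
  by apply: (@measurableT _ (g_sigma_algebraType _)).
transitivity (\int[P]_(w in A `&` [set w | degree (X^~ w) r v = n])
    ((q ^+ n)%:E * (q ^+ (\sum_(v <- l) degree (X^~ w) r v))%:E)).
  apply: eq_integral => w; rewrite inE => -[_ /= <-].
  by rewrite big_cons exprD EFinM.
rewrite ge0_integralZl//; last 3 first.
- exact: mint.
- by move=> w _; rewrite lee_fin exprn_ge0.
- by rewrite lee_fin exprn_ge0.
rewrite IH//.
  rewrite PAn -[P A]fineK ?fin_num_measure// -!EFinM; congr EFin; ring.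
move=> B FB.
have := hA (fun u => if u == v then [set w | degree (X^~ w) r v = n] else B u).
have eqB u : u \in l -> (u == v) = false.
  by move=> ul'; apply/eqP => uv; rewrite -uv ul' in vl.
rewrite !big_cons eqxx.
rewrite (eq_big_seq B); last by move=> u /eqB /= ->.
rewrite (eq_big_seq (fun u => P (B u))); last by move=> u /eqB /= ->.
rewrite setIA => ->.
  by rewrite PAn probability_degree ?muleA//; exact: hX.1.
move=> u; rewrite inE; case: eqP => [-> _|_ /= /FB//].
exact: sigma_generated_degree.
Qed.

Lemma pgf_generationS i (q : R) : (0 <= q)%R ->
  \int[P]_w (q ^+ size (generation (X^~ w) th i.+1))%:E =
  \int[P]_w ((expR (- (th i * (1 - q)))) ^+ size (generation (X^~ w) th i))%:E.
Proof.
move=> q0.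
have mgen j : countably_measurable (fun w => generation (X^~ w) th j).
  exact: (countably_measurable_generation (X := fun w u => X u w)).
have mint j (z : R) : measurable_fun setT
    (fun w => (z ^+ size (generation (X^~ w) th j))%:E).
  apply/measurable_EFinP.
  apply: (measurableT_comp (f := fun n : nat => (z ^+ n)%R)) => //.
  move=> _ B mB; apply: measurableI => //.
  exact: (countably_measurable_comp size (mgen j) B).
pose Y w := pickle (generation (X^~ w) th i).
have mY : countably_measurable Y.
  exact: (countably_measurable_comp pickle (mgen i)).
rewrite (integral_partition mY)//; last first.
  by move=> w; rewrite lee_fin exprn_ge0.
rewrite [RHS](integral_partition mY)//.
apply: eq_eseriesr => n _; rewrite !setTI.
have [->|/set0P[w0 /= Yn]] := eqVneq [set w | Y w = n] set0.
  by rewrite !integral_set0.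
set l0 := generation (X^~ w0) th i.
have -> : [set w | Y w = n] = [set w | generation (X^~ w) th i = l0].
  apply/seteqP; split=> w /=; first by rewrite -Yn => /(pcan_inj pickleK).
  by rewrite /Y => ->.
have mE : measurable [set w | generation (X^~ w) th i = l0].
  exact: (mgen i [set l0]).
transitivity (\int[P]_(w in [set w | generation (X^~ w) th i = l0])
   (q ^+ (\sum_(v <- l0) degree (X^~ w) (th i) v))%:E).
  by apply: eq_integral => w; rewrite inE /= size_generationS => ->.
rewrite integral_offspring_pgf//; last 2 first.
- exact: uniq_generation.
- move=> B FB; have [_ ] := generation_independent_beyond i l0; apply => //.
    exact: uniq_generation.
  by move=> v /mem_generation_size ->.
rewrite muleC -integral_cst//; apply: eq_integral => w.
by rewrite inE => /= ->.
Qed.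

End generation_law.

(** * Survival probabilities *)

Section bernoulli.
Context {R : realDomainType}.

Lemma bernoulli_ge (x : R) n : -1 <= x -> 1 + x *+ n <= (1 + x) ^+ n.
Proof.
move=> x1; elim: n => [|n IH]; first by rewrite mulr0n addr0 expr0.
rewrite exprS (le_trans _ (ler_wpM2l _ IH))//; last by rewrite -lerBlDl sub0r.
rewrite -[x *+ n]mulr_natr mulrS -[x *+ n]mulr_natr.
have n0 : 0 <= n%:R :> R by [].
have := sqr_ge0 x; nra.
Qed.

End bernoulli.

(* With [q = 1 - s], the generating function [s |-> exp (- r (1 - s))] of the
   Poisson law becomes [q |-> 1 - offspring_survival r q]: if each child is
   marked with probability [q], this is the probability to have a marked child.
     *)
Definition offspring_survival (R : realType) (r q : R) : R := 1 - expR (- (r *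
  q)).

(** The probability that generation [i] contains a marked vertex when its vertices are marked
    independently with probability [q]; see [pgf_generation]. The recursion peels off the last
    generation, whose level therefore acts first on [q]. *)
Fixpoint survival (R : realType) (th : nat -> R) (i : nat) (q : R) : R :=
  if i is j.+1 then survival th j (offspring_survival (th j) q) else q.

Section offspring_survival.
Context {R : realType}.
Implicit Types r q : R.

Lemma offspring_survival_ge0 r q : 0 <= r -> 0 <= q ->
  0 <= offspring_survival r q.
Proof.
by move=> r0 q0; rewrite subr_ge0 expR_le1 oppr_le0 mulr_ge0.
Qed.

Lemma offspring_survival_gt0 r q : 0 < r -> 0 < q -> 0 < offspring_survival r q.
Proof.
by move=> r0 q0; rewrite subr_gt0 expR_lt1 oppr_lt0 mulr_gt0.
Qed.

Lemma offspring_survival_le1 r q : offspring_survival r q <= 1.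
Proof. by rewrite gerBl expR_ge0. Qed.

Lemma le_offspring_survival r : 0 <= r ->
  {homo offspring_survival r : q q' / q <= q'}.
Proof.
move=> r0 q q' qq'; rewrite /offspring_survival.
have : expR (- (r * q')) <= expR (- (r * q)) by rewrite ler_expR lerN2
  ler_wpM2l.
lra.
Qed.

(** With [t = r * q] this is [exp (- t) <= (1 + t)^-1]. In terms of inverses the map is dominated by
    an affine one, whose iterates are explicit. *)
Lemma offspring_survival_inv r q : 0 < r -> 0 < q ->
  (offspring_survival r q)^-1 <= (r * q)^-1 + 1.
Proof.
move=> r0 q0; have t0 : 0 < r * q by rewrite mulr_gt0.
rewrite -[X in _ <= X]invrK lef_pV2 ?posrE ?offspring_survival_gt0//;
  last first.
  by rewrite invr_gt0 addr_gt0// invr_gt0.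
rewrite -[X in _ + X](divff (lt0r_neq0 t0)) -[X in X + _]mul1r -mulrDl invfM
  invrK.
rewrite /offspring_survival lerBrDl -lerBrDr.
rewrite (_ : 1 - _ = (1 + r * q)^-1); last by field; lra.
by rewrite expRN lef_pV2 ?posrE ?expR_gt0 ?expR_ge1Dx//; lra.
Qed.

(** Concavity in [q]: the graph lies below its tangent at [a]. *)
Lemma offspring_survivalB r a b : 0 <= r ->
  offspring_survival r b - offspring_survival r a <= r * expR (- (r * a)) * (b -
    a).
Proof.
move=> r0; rewrite /offspring_survival.
have := expR_ge1Dx (- (r * (b - a))).
rewrite (_ : expR (- (r * b)) = expR (- (r * a)) * expR (- (r * (b - a)))).
  by have := expR_gt0 (- (r * a)); nra.
by rewrite -expRD; congr expR; ring.
Qed.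

(** Square [1 - q / 2 <= exp (- q / 2)], whose left side is nonnegative for [q <= 1]. The quadratic
    loss drives the critical iterates to 0. *)
Lemma offspring_survival1_le q : q <= 1 -> offspring_survival 1 q <= q - q ^+ 2
  / 4.
Proof.
move=> q1; rewrite /offspring_survival mul1r.
have h : 1 - q / 2 <= expR (- q / 2) by rewrite (le_trans _ (expR_ge1Dx _))//
  mulNr.
rewrite (_ : - q = - q / 2 + - q / 2); last by field.
by rewrite expRD; have := expR_gt0 (- q / 2); nra.
Qed.

Lemma survival_cst th r i q : (forall j, (j < i)%N -> th j = r) ->
  survival th i q = iter i (offspring_survival r) q.
Proof.
elim: i q => [//|i IH] q h; rewrite /= h// IH; last by move=> j ji;
  apply/h/ltnW.
by rewrite -iterSr.
Qed.

Lemma survivalD th i j q :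
  survival th (i + j) q = survival th i (survival (fun k => th (i + k)%N) j q).
Proof.
by elim: j q => [|j IH] q; rewrite ?addn0// addnS /= IH.
Qed.

Lemma iter_offspring_survival_gt0 r k q : 0 < r -> 0 < q ->
  0 < iter k (offspring_survival r) q.
Proof. by move=> r0 q0; elim: k => //= k; exact: offspring_survival_gt0. Qed.

(** Iterates the affine bound [u |-> u / r + 1], whose fixed point is [r / (r - 1)]. *)
Lemma iter_offspring_survival_inv r k q : 1 < r -> 0 < q ->
  (iter k (offspring_survival r) q)^-1 <= (r ^+ k)^-1 * q^-1 + r / (r - 1).
Proof.
move=> r1 q0; have r0 : 0 < r by rewrite (lt_trans ltr01).
have d0 : 0 < r - 1 by rewrite subr_gt0.
have e0 : 0 <= r / (r - 1) by rewrite divr_ge0 ?ltW.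
elim: k => [|k IH]; first by rewrite /= expr0 invr1 mul1r lerDl.
rewrite iterS (le_trans (offspring_survival_inv r0 _))//.
  exact: iter_offspring_survival_gt0.
rewrite invfM exprS invfM.
have /(ler_wpM2l (ltW _)) := IH; move=> /(_ r^-1);
  rewrite invr_gt0 => /(_ r0) h.
have e : r^-1 * (r / (r - 1)) + 1 = r / (r - 1) by field; lra.
by rewrite mulrDr mulrA in h; lra.
Qed.

(* On [eta, 1] the map [offspring_survival r] is a contraction as soon as
   [ln r < r eta]. *)
Lemma iter_offspring_survival_contract r : 1 < r ->
  exists (eta kappa : R), [/\ 0 < eta, eta < 1 - r^-1, 0 <= kappa, kappa < 1 &
    forall k q, eta <= q -> q <= 1 ->
      iter k (offspring_survival r) 1 - iter k (offspring_survival r) q <= kappa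
        ^+ k].
Proof.
move=> r1; have r0 : 0 < r by rewrite (lt_trans ltr01).
have lnr : ln r < r - 1.
  rewrite -ltr_expR lnK//; have := @expR_gt1Dx _ (r - 1).
  by rewrite subr_eq0 gt_eqF// => /(_ isT); rewrite addrC subrK.
have lnr0 : 0 < ln r by rewrite ln_gt0.
(* [r * eta] is the midpoint of [ln r] and [r - 1]: above [ln r] the slope at [eta] is less than 1,
   and below [r - 1] the map sends [eta] above itself. *)
pose eta := (ln r + (r - 1)) / 2 / r.
have reta : r * eta = (ln r + (r - 1)) / 2 by rewrite /eta mulrC divfK ?gt_eqF.
have eta0 : 0 < eta by rewrite /eta !divr_gt0//; lra.
have eta1 : eta < 1 - r^-1.
  rewrite -(ltr_pM2l r0) reta mulrBr mulr1 divff ?gt_eqF//; lra.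
exists eta, (r * expR (- (r * eta))); split => //.
- by rewrite mulr_ge0 ?expR_ge0 ?ltW.
- rewrite -[X in X * _]lnK ?posrE// -expRD expR_lt1 reta; lra.
have stable : eta <= offspring_survival r eta.
  rewrite -[eta <= _]lef_pV2 ?posrE ?offspring_survival_gt0//.
  rewrite (le_trans (offspring_survival_inv r0 eta0))//.
  have e : eta^-1 - (r * eta)^-1 = (1 - r^-1) / eta by field; lra.
  have : 1 <= (1 - r^-1) / eta by rewrite ler_pdivlMr// mul1r ltW.
  lra.
move=> k q etaq q1.
have stay j : eta <= iter j (offspring_survival r) q.
  elim: j => [//|j IH] /=; rewrite (le_trans stable)//.
  exact: le_offspring_survival (ltW r0) _ _ IH.
have mono j : iter j (offspring_survival r) q <= iter j (offspring_survival r)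
  1.
  by elim: j => [//|j IH] /=; exact: le_offspring_survival (ltW r0) _ _ IH.
elim: k => [|k IH]; first by rewrite /= expr0; lra.
rewrite !iterS (le_trans (offspring_survivalB _ _ (ltW r0)))//.
rewrite exprS ler_pM//.
- by rewrite mulr_ge0 ?expR_ge0// ltW.
- by rewrite subr_ge0.
- by rewrite ler_pM2l// ler_expR lerN2 ler_pM2l.
Qed.

(** Iterates staying above [e] would lose at least [e ^ 2 / 4] each time and become negative. *)
Lemma iter_offspring_survival1 (e : R) : 0 < e ->
  exists k, iter k (offspring_survival 1) 1 < e.
Proof.
move=> e0; apply: contrapT => /forallNP h.
have {}h k : e <= iter k (offspring_survival 1) 1 by rewrite leNgt;
  apply/negP/h.
have b1 k : iter k (offspring_survival 1) 1 <= 1 :> R.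
  by case: k => [//|k]; exact: offspring_survival_le1.
have dec k : iter k (offspring_survival 1) 1 <= 1 - (e ^+ 2 / 4) *+ k.
  elim: k => [|k IH]; first by rewrite mulr0n subr0.
  rewrite iterS (le_trans (offspring_survival1_le (b1 k)))// [_ *+ k.+1]mulrSr.
  have : e ^+ 2 <= iter k (offspring_survival 1) 1 ^+ 2.
    by rewrite ler_pXn2r ?nnegrE ?(ltW e0)// (le_trans (ltW e0)).
  move: IH; set w := _ *+ k; set u := iter _ _ _; lra.
have [k] : exists k : nat, 1 < (e ^+ 2 / 4) *+ k.
  exists (Num.truncn ((e ^+ 2 / 4)^-1)).+1.
  have e4 : 0 < e ^+ 2 / 4 by rewrite divr_gt0 ?exprn_gt0.
  rewrite -mulr_natr -(ltr_pM2l (_ : 0 < (e ^+ 2 / 4)^-1)) ?invr_gt0// mulr1.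
  by rewrite mulKf ?gt_eqF// truncnS_gt.
by have := dec k; have := h k; lra.
Qed.

End offspring_survival.

(** * Probabilities of extinction and of small generations *)

Section generation_probability.
Context d (T : measurableType d) (R : realType) (P : probability T R).
Context (X : vertex -> {RV P >-> R}).
Hypothesis hX : is_PWIT X.
Local Open Scope ereal_scope.

Local Notation gen th i w := (generation (X^~ w) th i).

Lemma measurable_generation th i (A : set (seq vertex)) :
  measurable [set w | A (gen th i w)].
Proof. exact: (countably_measurable_generation (X := fun w u => X u w)). Qed.

Lemma measurable_size_generation th i (A : set nat) :
  measurable [set w | A (size (gen th i w))].
Proof. exact: (measurable_generation th i (fun l => A (size l))). Qed.

Lemma measurable_expr_generation th i (z : R) (E : set T) : measurable E ->
  measurable_fun E (fun w => (z ^+ size (gen th i w))%:E).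
Proof.
move=> mE; apply/measurable_EFinP.
apply: (measurableT_comp (f := fun n : nat => (z ^+ n)%R)) => //.
by move=> _ B mB; apply: measurableI => //; exact: measurable_size_generation.
Qed.

Lemma pgf_generation th i (q : R) : (forall j, 0 < th j)%R ->
  (0 <= q <= 1)%R ->
  \int[P]_w ((1 - q) ^+ size (gen th i w))%:E = (1 - survival th i q)%:E.
Proof.
move=> th0; elim: i q => [|i IH] q /andP[q0 q1].
  under eq_integral do rewrite expr1.
  rewrite integral_cst// -[RHS]mule1; congr (_ * _); exact: probability_setT.
rewrite pgf_generationS ?subr_ge0// -[RHS]/((1 - survival th i _)%:E) -IH.
  by apply: eq_integral => w _; rewrite /offspring_survival !subKr.
rewrite offspring_survival_le1 andbT; apply: offspring_survival_ge0 => //.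
exact: ltW.
Qed.

(** At [q = 1] the integrand [0 ^+ size] is the indicator of extinction, since [0 ^+ 0 = 1]. *)
Lemma probability_generation_nil th i : (forall j, 0 < th j)%R ->
  P [set w | size (gen th i w) = 0%N] = (1 - survival th i 1)%:E.
Proof.
move=> th0; rewrite -pgf_generation ?ler01 ?lexx//.
have mE := measurable_size_generation th i [set 0%N].
transitivity (\int[P]_w (\1_[set w | size (gen th i w) = 0%N] w)%:E).
  by rewrite integral_indic// setIT.
apply: eq_integral => w _; rewrite subrr indicE; congr EFin.
have [h|h] := eqVneq (size (gen th i w)) 0%N.
  by rewrite h expr0 mem_set.
by rewrite memNset ?expr0n ?(negbTE h)//= => /eqP; apply/negP.
Qed.

(** A Markov inequality: the generating function of generation [m] at [1 - q] is at least the
    probability that generation [k] is empty, where the integrand is 1, plus [(1 - q) ^+ L] times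
    the probability of the event. *)
Lemma probability_small_generation th k m (L : nat) (q : R) :
  (forall j, 0 < th j)%R -> (k <= m)%N -> (0 <= q < 1)%R ->
  P [set w | (0 < size (gen th k w))%N /\ (size (gen th m w) <= L)%N] <=
  ((survival th k 1 - survival th m q) / (1 - q) ^+ L)%:E.
Proof.
move=> th0 km /andP[q0 q1].
have q1' : (0 < 1 - q)%R by rewrite subr_gt0.
have ge0 n : 0 <= ((1 - q) ^+ n)%:E by rewrite lee_fin exprn_ge0// ltW.
set E := [set w | _ /\ _].
have mE : measurable E.
  apply: measurableI; first exact: (measurable_size_generation th k (fun n => 0
    < n)%N).
  exact: (measurable_size_generation th m (fun n => n <= L)%N).
have mN := measurable_size_generation th k [set 0%N].
rewrite EFinM lee_pdivlMr ?exprn_gt0//.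
have le1 : P E * ((1 - q) ^+ L)%:E <= \int[P]_(w in E) ((1 - q) ^+ size (gen th
  m w))%:E.
  rewrite muleC -integral_cst//; apply: ge0_le_integral => //.
  - by move=> w _; exact: ge0.
  - exact: measurable_expr_generation.
  - move=> w [_ hL]; rewrite lee_fin.
    by rewrite ler_wiXn2l// ?gerBl// ltW.
rewrite (le_trans le1)//.
have le2 : P [set w | size (gen th k w) = 0%N] +
   \int[P]_(w in E) ((1 - q) ^+ size (gen th m w))%:E <=
   \int[P]_w ((1 - q) ^+ size (gen th m w))%:E.
  have -> : P [set w | size (gen th k w) = 0%N] =
      \int[P]_(w in [set w | size (gen th k w) = 0%N]) ((1 - q) ^+ size (gen th
        m w))%:E.
    rewrite -[LHS]mul1e -integral_cst//; apply: eq_integral => w.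
    by rewrite inE /= => /(generation_nil km) ->; rewrite expr0.
  rewrite -ge0_integral_setU//=; last 2 first.
  - by apply: measurable_expr_generation; exact: measurableU.
  - by apply/disj_set2P/seteqP; split=> w // [/= k0 [/= + _]]; rewrite k0.
  apply: ge0_subset_integral => //.
  - exact: measurableU.
  - exact: measurable_expr_generation.
move: le2; rewrite probability_generation_nil// pgf_generation//;
  last by rewrite q0 ltW.
set I := integral _ _ _.
rewrite (_ : (survival th k 1 - survival th m q)%R =
  ((1 - survival th m q) - (1 - survival th k 1))%R); last by ring.
by move=> h; rewrite EFinB leeBrDl.
Qed.

Lemma probability_generation_gt0 th i : (forall j, 0 < th j)%R ->
  P [set w | (0 < size (gen th i w))%N] = (survival th i 1)%:E.
Proof.
move=> th0.
rewrite (_ : [set w | _] = ~` [set w | size (gen th i w) = 0%N]); last first.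
  apply/seteqP; split=> w /=; first by rewrite lt0n => /eqP.
  by move/eqP; rewrite lt0n.
rewrite probability_setC; last exact: (measurable_size_generation th i [set
  0%N]).
by rewrite probability_generation_nil// -EFinB subKr.
Qed.

Lemma probability_critical_survival (e : R) : (0 < e)%R ->
  exists k, P [set w | (0 < size (gen (fun _ => 1%R) k w))%N] <= e%:E.
Proof.
move=> e0; have [k hk] := iter_offspring_survival1 e0; exists k.
by rewrite probability_generation_gt0// (survival_cst (r := 1%R))// lee_fin ltW.
Qed.

(** [offspring_survival r] maps [1 - r^-1] above itself, by [offspring_survival_inv], so this value
    stays below all iterates started at 1. The events of extinction by generation [k] increase to
    the event considered. *)
Lemma probability_extinction (r : R) : (1 < r)%R ->
  P [set w | exists k, size (gen (fun _ => r) k w) = 0%N] <= (r^-1)%:E.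
Proof.
move=> r1; have r0 : (0 < r)%R by rewrite (lt_trans ltr01).
pose E k := [set w | size (gen (fun _ => r) k w) = 0%N].
have mE k : measurable (E k) by exact: (measurable_size_generation _ k [set
  0%N]).
rewrite (_ : [set w | _] = \bigcup_k E k); last first.
  by apply/seteqP; split=> w [k]; [exists k|exists k].
have cvgE : P (E n) @[n --> \oo] --> P (\bigcup_k E k).
  apply: nondecreasing_cvg_mu => //; first exact: bigcupT_measurable.
  by move=> i j ij; apply/subsetPset => w; exact: generation_nil.
rewrite -(cvg_lim _ cvgE)//; apply: lime_le; first by apply/cvg_ex; eexists;
  exact: cvgE.
apply: nearW => k; rewrite /E probability_generation_nil// lee_fin.
rewrite (survival_cst (r := r))// lerBlDl -lerBlDr.
elim: k => [|k IH]; first by rewrite gerBl invr_ge0 ltW.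
have q0 : (0 < 1 - r^-1)%R by rewrite subr_gt0 invf_lt1.
rewrite iterS (le_trans _ (le_offspring_survival (ltW r0) IH))//.
rewrite -[X in (X <= _)%R]invrK -[X in (_ <= X)%R]invrK.
rewrite lef_pV2 ?posrE ?invr_gt0 ?offspring_survival_gt0//.
rewrite (le_trans (offspring_survival_inv r0 q0))// le_eqVlt; apply/orP; left.
by apply/eqP; field; rewrite subr_eq0 !gt_eqF.
Qed.

(** After extinction the sum is finite and no longer depends on [k], so the events decrease to the
    empty set as [m] grows. *)
Lemma extinct_size_tight th (e : R) : (0 < e)%R -> exists m : nat,
  measurable [set w | exists k, size (gen th k w) = 0%N /\
    (m <= \sum_(i < k) size (gen th i w))%N] /\
  P [set w | exists k, size (gen th k w) = 0%N /\
    (m <= \sum_(i < k) size (gen th i w))%N] <= e%:E.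
Proof.
move=> e0.
pose E m := [set w | exists k, size (gen th k w) = 0%N /\
  (m <= \sum_(i < k) size (gen th i w))%N].
have mE m : measurable (E m).
  rewrite (_ : E m = \bigcup_k ([set w | size (gen th k w) = 0%N] `&`
    [set w | (m <= sumn [seq size (gen th i w) | i <- index_iota 0 k])%N])).
    apply: bigcupT_measurable => k; apply: measurableI.
      exact: (measurable_size_generation th k [set 0%N]).
    have : countably_measurable (fun w => [seq size (gen th i w) | i <-
      index_iota 0 k]).
      apply: countably_measurable_seq => i A; exact: measurable_size_generation.
    exact: (fun h => h (fun l => m <= sumn l)%N).
  apply/seteqP; split=> w /=.
    by move=> [k [k0 mk]]; exists k => //; rewrite /= sumnE big_map big_mkord.
  by move=> [k _ [k0 mk]]; exists k; rewrite /= sumnE big_map big_mkord in mk.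
have sumE w k k' : (k <= k')%N -> size (gen th k w) = 0%N ->
    (\sum_(i < k') size (gen th i w))%N = (\sum_(i < k) size (gen th i w))%N.
  move=> /subnKC <- k0; rewrite -(big_mkord xpredT (fun i =>
    size (gen th i w))).
  rewrite (big_cat_nat (n := k)) ?leq_addr//= big_mkord.
  rewrite [X in (_ + X)%N]big_nat [X in (_ + X)%N]big1 ?addn0// =>
    i /andP[ki _].
  exact: generation_nil ki k0.
have cvgE : P (E n) @[n --> \oo] --> P (\bigcap_k E k).
  apply: nonincreasing_cvg_mu => //.
  - by rewrite ltey_eq fin_num_measure.
  - exact: bigcapT_measurable.
  - move=> i j ij; apply/subsetPset => w [k [k0 h]]; exists k; split=> //.
    exact: leq_trans h.
move: cvgE; rewrite (_ : \bigcap_k E k = set0) ?measure0; last first.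
  apply/seteqP; split=> w //= hw; have [k [k0 _]] := hw 0%N I.
  have [k' [k'0]] := hw (\sum_(i < k) size (gen th i w))%N.+1 I.
  case: (leqP k k') => [kk'|/ltnW k'k]; first by rewrite (sumE _ _ _ kk' k0)
    ltnn.
  by rewrite (sumE _ _ _ k'k k'0) ltnn.
move=> /fine_cvgP[_ /cvgrPdist_le/(_ _ e0)].
move=> [m _ /(_ m (leqnn m))]; rewrite sub0r normrN /= => hm; exists m; split;
  first exact: mE.
rewrite -[P _]fineK ?fin_num_measure//; last exact: mE.
by rewrite lee_fin (le_trans (ler_norm _)).
Qed.

End generation_probability.

(** * Supercritical growth followed by nearly critical growth *)

Definition two_levels (R : realType) (r y : R) (k : nat) (j : nat) : R :=
  if (j < k)%N then r else y.

Section two_stage_growth.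
Context {R : realType}.

(* From the marking probability [1 / (2 L)], the [l] nearly critical generations
   lead to about [1 / N]; [N ^ 2] further generations at the supercritical level
   [r] reach a fixed positive threshold, and in the last [N] generations the
   contraction takes over. *)
Lemma two_stage_survival (r e : R) : 1 < r -> 0 < e ->
  exists N0 : nat, forall N l L (y : R), (N0 <= N)%N -> 1 < y ->
    y / (y - 1) <= N%:R + 3 -> (0 < L)%N -> L%:R <= y ^+ l ->
    survival (two_levels r y (N * N + N)) (N * N + N) 1 -
      survival (two_levels r y (N * N + N)) (N * N + N + l) (2 * L%:R)^-1 <= e.
Proof.
move=> r1 e0; have r0 : 0 < r by rewrite (lt_trans ltr01).
have [eta [kappa [eta0 eta1 kappa0 kappa1 contract]]] :=
  iter_offspring_survival_contract r1.
have ri0 : 0 < 1 - r^-1 by rewrite subr_gt0 invf_lt1.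
(* The room left by the fixed point in [iter_offspring_survival_inv]: the iterate exceeds [eta] once
   [s^-1 <= c * r ^+ (N * N)]. *)
pose c := eta^-1 - r / (r - 1).
have c0 : 0 < c.
  rewrite subr_gt0 (_ : r / (r - 1) = (1 - r^-1)^-1) ?ltf_pV2 ?posrE//.
  by field; rewrite subr_eq0 !gt_eqF.
have [N1 _ hN1] : \forall N \near \oo, kappa ^+ N <= e.
  have /cvgrPdist_le/(_ _ e0) : kappa ^+ N @[N --> \oo] --> 0.
    by apply: cvg_expr; rewrite ger0_norm.
  apply: filterS => N; rewrite sub0r normrN; exact: le_trans (ler_norm _).
(* The second bound gives [6 <= N * c * (r - 1)], hence [N + 5 <= 6 * N <= c * N ^ 2 * (r - 1) <= c
   * r ^+ (N * N)], the last step by Bernoulli. *)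
exists (maxn N1 (Num.truncn (6 / (c * (r - 1)))).+1) => N l L y.
move=> NN y1 hy L0 Ll; set th := two_levels _ _ _.
have NN1 := leq_trans (leq_maxl _ _) NN.
have NN2 := leq_trans (leq_maxr _ _) NN.
have y0 : 0 < y by rewrite (lt_trans ltr01).
have N0 : 0 < N%:R :> R by rewrite ltr0n (leq_trans _ NN2).
have L0' : 0 < L%:R :> R by rewrite ltr0n.
have L1 : 1 <= L%:R :> R by rewrite ler1n.
set q := (2 * L%:R)^-1; have q0 : 0 < q by rewrite invr_gt0 mulr_gt0.
have q1 : q <= 1 by rewrite invf_le1 ?mulr_gt0//; lra.
rewrite [X in _ - X]survivalD; set s := survival _ l q.
have sE : s = iter l (offspring_survival y) q.
  apply: survival_cst => j _; rewrite /th /two_levels.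
  by rewrite -[X in (_ < X)%N]addn0 ltn_add2l.
rewrite !(survival_cst (r := r)); last 2 first.
- by move=> j; rewrite /th /two_levels => ->.
- by move=> j; rewrite /th /two_levels => ->.
have s0 : 0 < s by rewrite sE; exact: iter_offspring_survival_gt0.
have s1 : s <= 1.
  by rewrite sE; case: (l) => [//|j]; exact: offspring_survival_le1.
(* The [l] generations reduce [q^-1 = 2 * L] to at most 2, as [L <= y ^+ l]; the fixed point
   [y / (y - 1)] adds at most [N + 3]. *)
have sV : s^-1 <= N%:R + 5.
  rewrite sE (le_trans (iter_offspring_survival_inv _ y1 q0))// invrK.
  have : (y ^+ l)^-1 * (2 * L%:R) <= 2.
    by rewrite mulrC ler_pdivrMr ?exprn_gt0// ler_pM2l.
  lra.
rewrite addnC !iterD.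
set a := iter (N * N) _ 1; set b := iter (N * N) _ s.
have a1 : a <= 1 by rewrite /a; case: (N * N)%N => [//|j];
  exact: offspring_survival_le1.
have b1 : b <= 1 by rewrite /b; case: (N * N)%N => [//|j];
  exact: offspring_survival_le1.
have b0 : 0 < b by exact: iter_offspring_survival_gt0.
have etab : eta <= b.
  rewrite -lef_pV2 ?posrE// (le_trans (iter_offspring_survival_inv _ r1 s0))//.
  rewrite -lerBrDr -/c mulrC ler_pdivrMr ?exprn_gt0// (le_trans sV)//.
  have h1 : 1 <= N%:R :> R by rewrite ler1n -(ltr0n R).
  have h2 : 6 <= N%:R * (c * (r - 1)).
    have cr0 : 0 < c * (r - 1) by rewrite mulr_gt0// subr_gt0.
    rewrite -ler_pdivrMr//.
    by rewrite (le_trans (ltW (truncnS_gt _)))// ler_nat.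
  have h3 : (N%:R * N%:R) * (r - 1) <= r ^+ (N * N).
    have := @bernoulli_ge _ (r - 1) (N * N).
    rewrite (addrC 1 (r - 1)) subrK -[(r - 1) *+ _]mulr_natr natrM =>
      /(_ ltac:(lra)); lra.
  have h : c * (N%:R * N%:R * (r - 1)) <= c * r ^+ (N * N) by rewrite ler_pM2l.
  have h4 : N%:R + 5 <= 6 * N%:R :> R by lra.
  rewrite (le_trans h4)// (le_trans _ h)//.
  by have := ler_wpM2l (ltW N0) h2; lra.
have mono : iter N (offspring_survival r) a <= iter N (offspring_survival r) 1.
  elim: (N) => [//|j IH] /=; exact: le_offspring_survival (ltW r0) _ _ IH.
by have := contract N b etab b1; have := hN1 N NN1; rewrite /=; lra.
Qed.

End two_stage_growth.

Section two_stage_probability.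
Context d (T : measurableType d) (R : realType) (P : probability T R).
Context (X : vertex -> {RV P >-> R}).
Hypothesis hX : is_PWIT X.

(** With [q = (2 * L)^-1] Bernoulli gives [(1 - q) ^+ L >= 1 / 2], so the difference of survival
    probabilities is made at most [e / 2]. *)
Lemma two_stage_probability (r e : R) : 1 < r -> 0 < e ->
  exists N0 : nat, forall N l L (y : R), (N0 <= N)%N -> 1 < y ->
    y / (y - 1) <= N%:R + 3 -> (0 < L)%N -> L%:R <= y ^+ l ->
    (P [set w |
      (0 < size (generation (X^~ w) (two_levels r y (N * N + N)) (N * N + N)))%N
        /\
      (size (generation (X^~ w) (two_levels r y (N * N + N)) (N * N + N + l))
        <= L)%N] <= e%:E)%E.
Proof.
move=> r1 e0; have e2 : 0 < e / 2 by rewrite divr_gt0.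
have [N0 h] := two_stage_survival r1 e2; exists N0 => N l L y NN0 y1 hy L0 Ll.
set k := (N * N + N)%N; set th := two_levels r y k.
have L0' : 0 < L%:R :> R by rewrite ltr0n.
have L1 : 1 <= L%:R :> R by rewrite ler1n.
have q0 : 0 < (2 * L%:R)^-1 :> R by rewrite invr_gt0 mulr_gt0.
have q1 : (2 * L%:R)^-1 < 1 :> R by rewrite invf_lt1 ?mulr_gt0//; lra.
have th0 j : 0 < th j by rewrite /th /two_levels; case: ifP => _; lra.
have := probability_small_generation hX L th0 (leq_addr l k) (q := (2 *
  L%:R)^-1).
rewrite ltW//= => /(_ q1) hP; rewrite (le_trans hP)// lee_fin.
rewrite ler_pdivrMr ?exprn_gt0 ?subr_gt0// (le_trans (h _ _ _ _ NN0 y1 hy L0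
  Ll))//.
rewrite ler_pM2l//.
rewrite (le_trans _ (bernoulli_ge _ _))//; last by rewrite lerN2 ltW.
rewrite (_ : - _ *+ L = - (2^-1)); last by rewrite -mulr_natr; field; lra.
lra.
Qed.

End two_stage_probability.

(** * Invasion percolation *)

(** The almost sure properties under which invasion and freezing are then studied
    deterministically. *)
Definition locally_finite (R : realType) (x : vertex -> R) : Prop :=
  (forall v k, 0 < x (rcons v k) /\ x (rcons v k) <= x (rcons v k.+1)) /\
  forall v r, exists k, r < x (rcons v k).

Lemma ae_forall_count d (T : measurableType d) (R : realType)
    (mu : {measure set T -> \bar R}) (S : countType) (Q : S -> T -> Prop) :
  (forall s, {ae mu, forall w, Q s w}) -> {ae mu, forall w s, Q s w}.
Proof.
move=> hQ.
have h : {ae mu, forall w n, if unpickle n is Some s then Q s w else True}.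
  apply: ae_foralln => n; case: (unpickle n) => [s|]; first exact: hQ.
  by apply: aeW.
by apply: filterS h => w h s; have := h (pickle s); rewrite pickleK.
Qed.

Section ae_locally_finite.
Context d (T : measurableType d) (R : realType) (P : probability T R).
Context (X : vertex -> {RV P >-> R}).
Hypothesis hX : is_PWIT X.

Lemma ae_locally_finite : {ae P, forall w, locally_finite (X^~ w)}.
Proof.
have [hP _] := hX.
have h1 : {ae P, forall w v,
    forall k, 0 < X (rcons v k) w /\ X (rcons v k) w <= X (rcons v k.+1) w}.
  by apply: (@ae_forall_count _ _ _ P vertex) => v; exact: (hP v).1.
have h2 : {ae P, forall w (p : vertex * nat), exists k, p.2.+1%:R < X (rcons p.1
  k) w}.
  apply: (@ae_forall_count _ _ _ P (vertex * nat)%type) => -[v m].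
  have h := ae_exists_counts_to (fun k => measurable_funPT (X (rcons v k)))
    (hP v) (ltr0Sn R m).
  by apply: filterS h => w [k [rk _]]; exists k.
apply: filterS2 h1 h2 => w h1 h2; split=> // v r.
have [k hk] := h2 (v, Num.truncn r).
by exists k; rewrite (lt_trans (truncnS_gt r)).
Qed.

End ae_locally_finite.

(** * Invasion and branching on a fixed locally finite tree *)

Section locally_finite_trees.
Context {R : realType} (x : vertex -> R).
Hypothesis hx : locally_finite x.
Implicit Types (r : R) (v : vertex).

Lemma ltn_degree r v k : (k < degree x r v)%N = (x (rcons v k) <= r).
Proof.
have mono i j : (i <= j)%N -> x (rcons v i) <= x (rcons v j).
  move=> /subnKC <-; elim: (j - i)%N => [|l IH]; first by rewrite addn0.
  by rewrite addnS (le_trans IH)//; exact: (hx.1 v (i + l)%N).2.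
have /degreeP [[rd hd]|[_ h]] := erefl (degree x r v); last first.
  by have [i /lt_le_trans/(_ (h i))] := hx.2 v r; rewrite ltxx.
have [/hd //|dk] := ltnP; apply/esym/negbTE; rewrite -ltNge.
exact: lt_le_trans (mono _ _ dk).
Qed.

Lemma mem_generation th i v : v \in generation x th i <->
  size v = i /\ forall j, (j < i)%N -> x (take j.+1 v) <= th j.
Proof.
elim: i v => [|i IH] v.
  by rewrite inE; split=> [/eqP ->|[/size0nil -> _]].
split.
  move=> /mem_generationS[u [k [/IH[su hu] kd ->]]]; rewrite size_rcons su.
  split=> // j; rewrite ltnS leq_eqVlt => /orP[/eqP ->|ji].
    by rewrite -su -[X in X <= _]/(x _) take_oversize ?size_rcons//
      su -ltn_degree.
  by rewrite -cats1 takel_cat ?su//; exact: hu.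
case/lastP: v => [[]//|u k]; rewrite size_rcons => -[[su] h].
apply/mem_generationS; exists u, k; split=> //.
  apply/IH; split=> // j ji; have := h j (ltnW ji).
  by rewrite -cats1 takel_cat ?su.
rewrite ltn_degree; have := h i (ltnSn i).
by rewrite take_oversize ?size_rcons ?su.
Qed.

Lemma birth_time_generation (f : R -> R) th i v : {homo f : a b / a <= b} ->
  v \in generation x th i -> birth_time f x v <= \sum_(j < i) f (th j).
Proof.
move=> mf /mem_generation[sv h]; rewrite /birth_time sv big_add1 /= big_mkord.
by apply: ler_sum => j _; apply: mf; exact: h.
Qed.

Lemma birth_time_ge0 (f : R -> R) v : (forall a, 0 <= f a) ->
  0 <= birth_time f x v.
Proof. by move=> f0; apply: sumr_ge0. Qed.

Lemma le_birth_time (f : R -> R) v j : (forall a, 0 <= f a) -> (j < size v)%N ->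
  f (x (take j.+1 v)) <= birth_time f x v.
Proof.
move=> f0 jv; rewrite /birth_time big_add1 /= big_mkord.
by rewrite (bigD1 (Ordinal jv))//= lerDl sumr_ge0.
Qed.

(** A single edge of weight above [r] already costs at least [f r > t]. *)
Lemma branching_process_generation (f : R -> R) (t r : R) v :
  (forall a, 0 <= f a) -> {homo f : a b / a <= b} -> t < f r ->
  branching_process f x t v -> v \in generation x (fun _ => r) (size v).
Proof.
move=> f0 mf tr vt; apply/mem_generation; split=> // j jv; rewrite leNgt.
apply/negP => /ltW /mf; apply/negP; rewrite -ltNge.
by rewrite (le_lt_trans _ tr)// (le_trans (le_birth_time f0 jv)).
Qed.

Let cluster r : set vertex := [set v | v \in generation x (fun _ =>
  r) (size v)].

Let cluster_rcons r v k : cluster r (rcons v k) <-> cluster r v /\ x (rcons v k)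
  <= r.
Proof.
rewrite /cluster /= size_rcons; split.
  move=> /mem_generationS[u [j [uv + /rcons_inj[vu kj]]]].
  by rewrite -vu -kj in uv *; rewrite ltn_degree.
by move=> [vc xr]; apply/mem_generationS; exists v, k; rewrite ltn_degree.
Qed.

Let invasion_root k : invasion x k [::].
Proof. by elim: k => //= k IH; left. Qed.

Let invasionS_sub k : invasion x k `<=` invasion x k.+1.
Proof. by move=> v vk; left. Qed.

Let finite_low_boundary (S : set vertex) c : finite_set S ->
  finite_set [set v | boundary S v /\ x v <= c].
Proof.
move=> finS.
apply: (@sub_finite_set _ _ (\bigcup_(u in S) [set` children u (degree x c
  u)])).
  move=> v [[_ [u [k [Su ->]]]] xc]; exists u => //=.
  by apply/mapP; exists k => //; rewrite mem_iota add0n ltn_degree.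
by apply: bigcup_finite => // u _; exact: finite_seq.
Qed.

(** Ties may add several vertices at once, but none of them is heavier than a fixed boundary vertex,
    so [finite_low_boundary] applies. *)
Let finite_invasion k : finite_set (invasion x k).
Proof.
elim: k => [|k IH]; first exact: finite_set1.
rewrite /= finite_setU; split=> //.
have [->|/set0P[u0 [bu0 _]]] := eqVneq
  [set v | boundary (invasion x k) v /\ forall u, boundary (invasion x k) u -> x
    v <= x u] set0.
  exact: finite_set0.
apply: sub_finite_set (finite_low_boundary (x u0) IH) => v [bv mv].
by split=> //; exact: mv.
Qed.

(** The boundary is nonempty, since the root has infinitely many children and only finitely many are
    invaded; its minimum is attained because only finitely many boundary vertices lie below a given
    weight. *)
Let invasion_strict k : exists v, invasion x k.+1 v /\ ~ invasion x k v.
Proof.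
have [u0 bu0] : exists u0, boundary (invasion x k) u0.
  apply: contrapT => /forallNP h; apply: infinite_nat.
  have inj : set_inj setT (fun j : nat => rcons ([::] : vertex) j).
    by move=> i j _ _ /= [].
  apply: (@sub_finite_set _ _ ((fun j : nat => rcons ([::] : vertex) j) @^-1`
    invasion x k)).
    move=> j _ /=; apply: contrapT => nj; apply: (h [:: j]); split=> //.
    by exists [::], j.
  by apply: finite_preimage => // i j _ _ /= [].
pose S := [set v | boundary (invasion x k) v /\ x v <= x u0].
have finS : finite_set S by exact: finite_low_boundary.
have /finite_seqP[l Sl] := finS.
have l0 : u0 \in l by have : S u0 by []; rewrite Sl.
have [v vl vmin] : exists2 v, v \in l & forall u, u \in l -> x v <= x u.
  elim: (l) u0 l0 {bu0 S finS Sl} => [//|a s IH] _ _.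
  have [->|[b bs]] : s = [::] \/ exists b, b \in s.
    by case: s {IH} => [|b s]; [left|right; exists b; rewrite inE eqxx].
    by exists a => [|u]; rewrite inE ?eqxx// => /eqP ->.
  have [c cs hc] := IH b bs; have [ac|ca] := leP (x a) (x c).
    exists a => [|u]; rewrite inE ?eqxx// => /orP[/eqP -> //|/hc];
      exact: le_trans.
  exists c => [|u]; rewrite inE ?cs ?orbT// => /orP[/eqP ->|/hc //]; exact: ltW.
have [bv vu0] : S v by rewrite Sl.
exists v; split; last by case: bv.
right; split=> // u bu; have [uu0|/ltW u0u] := leP (x u) (x u0).
  by apply: vmin; have : S u by []; rewrite Sl.
exact: le_trans u0u.
Qed.

(** The invasion gains a vertex at every step and stays in the root's cluster of edges of weight at
    most [r], which would be finite if a generation were empty. *)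
Lemma max_invaded_weight_lt r : (max_invaded_weight x < r%:E)%E ->
  forall k, (0 < size (generation x (fun _ => r) k))%N.
Proof.
move=> Mr K; rewrite lt0n; apply/negP => /eqP K0.
have inv_cluster k : invasion x k `<=` cluster r.
  elim: k => [|k IH] v; first by move=> ->.
  move=> vk; have [/IH //|nvk] := pselect (invasion x k v).
  case: (vk) => [//|[[_ [u [j [uk vE]]]] _]]; rewrite vE; apply/cluster_rcons.
  split; first exact: IH.
  rewrite -lee_fin (le_trans _ (ltW Mr))//; apply: ereal_sup_ubound.
  exists (rcons u j) => //; split; last by case: (u).
  by exists k.+1 => //; rewrite -vE.
pose l := flatten [seq generation x (fun _ => r) i | i <- iota 0 K].
have cluster_l v : cluster r v -> v \in l.
  move=> vc; apply/flattenP; exists (generation x (fun _ => r) (size v)) => //.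
  apply/mapP; exists (size v) => //; rewrite mem_iota add0n /= ltnNge.
  apply/negP => /generation_nil /(_ K0) /size0nil h.
  by move: vc; rewrite /cluster /= h.
pose s k := undup [seq v <- l | `[< invasion x k v >]].
have sz k : (k <= size (s k))%N.
  elim: k => [//|k IH]; rewrite (leq_ltn_trans IH)//.
  have [v [vk1 nvk]] := invasion_strict k.
  have vl : v \in l by apply/cluster_l/inv_cluster/vk1.
  have := @uniq_leq_size _ (v :: s k) (s k.+1); apply.
    rewrite /= undup_uniq andbT mem_undup mem_filter.
    by apply/negP => /andP[/asboolP].
  move=> u; rewrite inE !mem_undup !mem_filter =>
    /orP[/eqP ->|/andP[/asboolP uk ->]].
    by rewrite vl andbT; apply/asboolP.
  by rewrite andbT; apply/asboolP/invasionS_sub.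
have := sz (size l).+1; rewrite leqNgt => /negP; apply.
by rewrite ltnS (leq_trans (size_undup _))// size_filter count_size.
Qed.

(** If the cluster at level [r] is infinite, a long enough path in it leaves the invaded set through
    a boundary edge of weight at most [r], so the minimal boundary weight never exceeds [r]. *)
Lemma max_invaded_weight_gt r : (r%:E < max_invaded_weight x)%E ->
  exists k, size (generation x (fun _ => r) k) = 0%N.
Proof.
move=> rM; apply: contrapT => /forallNP h.
suff inv_cluster k : invasion x k `<=` cluster r.
  move: rM; rewrite ltNge => /negP; apply; apply: ge_ereal_sup.
  move=> _ [v [[k _ vk] vn] <-]; have /mem_generation[_ hv] := inv_cluster k v
    vk.
  case/lastP: v vn vk hv => [[]//|v j _ _]; rewrite size_rcons.
  move=> /(_ (size v) (ltnSn _)).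
  by rewrite take_oversize ?size_rcons// lee_fin.
elim: k => [|k IH] v; first by move=> ->.
have /finite_seqP[l Sl] := finite_invasion k.
pose K := (\max_(u <- l) size u).+1.
have [w wK] : exists w, w \in generation x (fun _ => r) K.
  have := h K; case: (generation _ _ _) => [//|w s] _.
  by exists w; rewrite inE eqxx.
have [sw hw] := (mem_generation _ _ _).1 wK.
have nw : ~ invasion x k w.
  rewrite Sl /= => wl; have : (size w <= \max_(u <- l) size u)%N.
    exact: (@leq_bigmax_seq _ l xpredT size).
  by rewrite sw ltnn.
have ex : exists j, ~~ `[< invasion x k (take j w) >].
  by exists K; rewrite take_oversize ?sw//; apply/asboolPn.
have [[|j] /asboolPn nj minj] := ex_minnP ex; first by rewrite take0 in nj.
have jK : (j < K)%N.
  by apply: minj; rewrite take_oversize ?sw//; apply/asboolPn.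
have ij : invasion x k (take j w).
  by apply: contrapT => /asboolPn/minj; rewrite ltnn.
have bj : boundary (invasion x k) (take j.+1 w).
  split=> //; exists (take j w), (nth 0%N w j); split=> //.
  by rewrite -take_nth ?sw.
move=> [/IH //|[[nv [u [i [ku vE]]]] minv]]; rewrite vE; apply/cluster_rcons.
split; first exact: IH.
by rewrite -vE (le_trans (minv _ bj))// hw.
Qed.

End locally_finite_trees.

(** * The Malthusian parameter and the discounted weights *)

Lemma integral_mrestr d (T : measurableType d) (R : realType)
    (mu : {measure set T -> \bar R}) (D E : set T) (mD : measurable D)
    (f : T -> \bar R) : measurable E -> measurable_fun E f ->
  (forall z, (0 <= f z)%E) ->
  (\int[mrestr mu mD]_(z in E) f z = \int[mu]_(z in E `&` D) f z)%E.
Proof.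
move=> mE mf f0; have mED : measurable (E `&` D) by exact: measurableI.
have mE'D : measurable (E `\` D) by exact: measurableD.
have disj : [disjoint E `&` D & E `\` D].
  by apply/disj_set2P/seteqP; split=> z // [[_ Dz] [_ ]].
rewrite -[in LHS](setUIDK E D) ge0_integral_setU//; last by rewrite setUIDK.
rewrite [X in (_ + X)%E]null_set_integral ?adde0//; last 2 first.
- exact: measurable_funS mf.
- by rewrite /= /mrestr setDE -setIA setICl setI0 measure0.
by apply: eq_measure_integral => A mA AED; rewrite /= /mrestr setIidl// =>
  z /AED[].
Qed.

Section exponential_tail.
Context {R : realType}.

Lemma integral_exponential_tail (b p : R) : 0 < b ->
  (\int[lebesgue_measure]_(z in `[p, +oo[) (expR (- (b * z)))%:E =
    (expR (- (b * p)) / b)%:E)%E.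
Proof.
move=> b0.
pose h (z : R) := - (b * z).
pose G : R -> R := (- b^-1) \*: (expR \o h).
have dh (z : R) : is_derive z 1 h (- b).
  have d1 : is_derive z (1 : R) (- (b \*: @id R)) (- (b *: (1 : R))).
    exact: is_deriveN.
  by apply: (is_derive_eq d1); rewrite -[_ *: _]/(b * 1) mulr1.
have dG (z : R) : is_derive z 1 G (expR (- (b * z))).
  have d2 : is_derive z (1 : R) (expR \o h) (expR (h z) * - b).
    exact: is_derive1_comp.
  have d3 : is_derive z (1 : R) G (- b^-1 *: (expR (h z) * - b))
    by exact: is_deriveZ.
  apply: (is_derive_eq d3); rewrite -[_ *: _]/(_ * _) mulrN mulrNN mulrC mulfK
    ?gt_eqF//.
have cG : continuous G.
  move=> z; apply: differentiable_continuous; apply/derivable1_diffP.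
  by have [] := dG z.
rewrite (@ge0_continuous_FTC2y _ _ G _ 0).
- rewrite sub0e -EFinN; congr EFin; rewrite /G /= -[_ *: _]/(_ * _).
  by rewrite mulNr opprK mulrC.
- by move=> z _; exact: expR_ge0.
- apply: continuous_subspaceT => z.
  have dz : is_derive z (1 : R) (expR \o h) (expR (h z) * - b).
    exact: is_derive1_comp.
  apply: differentiable_continuous; apply/derivable1_diffP.
  by have [] := dz.
- rewrite -(mulr0 (- b^-1)); apply: cvgMr.
  apply: (@cvg_comp _ _ _ (fun z => b * z) (fun z => expR (- z)) _ +oo%R).
    apply/cvgryPge => A; exists (A / b); split; first exact: num_real.
    by move=> z /ltW zA; rewrite mulrC -ler_pdivrMr.
  exact: cvgr_expR.
- by move=> z _; have [] := dG z.
- by apply: cvg_at_right_filter; exact: cG.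
- by move=> z _; rewrite derive1E; have [_ ->] := dG z.
Qed.

End exponential_tail.

Section discounted_weight.
Context {R : realType} (f : R -> R) (N : nat).
Hypotheses (f_ge0 : forall z, 0 <= f z) (ndf : {homo f : a b / a <= b})
  (f1_gt0 : 0 < f 1) (N_gt0 : (0 < N)%N)
  (growth : forall y z, 1 <= y -> y <= z -> f y * (z / y) ^+ N <= f z).

Let mu := @lebesgue_measure R.

(** The Laplace transform of [image_measure f], pulled back to Lebesgue measure: the Malthusian
    equation becomes [laplace l = 1]. *)
Definition laplace (l : R) : \bar R :=
  (\int[mu]_(z in `[0%R, +oo[) (expR (- (l * f z)))%:E)%E.

Let mf : measurable_fun setT f.
Proof. exact: nondecreasing_measurable. Qed.

Lemma measurable_discount (D : set R) l c : measurable_fun D (fun z =>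
  (expR (- (l * (f z - c))))%:E).
Proof.
apply: (@measurable_funS _ _ _ _ setT) => //.
apply/measurable_EFinP; apply: measurableT_comp => //.
apply: measurableT_comp => //; apply: measurable_funM => //.
exact: measurable_funB.
Qed.

Lemma measurable_laplace (D : set R) l : measurable_fun D (fun z =>
  (expR (- (l * f z)))%:E).
Proof. by have := @measurable_discount D l 0; under eq_fun do rewrite subr0.
  Qed.

Lemma linear_growth y z : 1 <= y -> y <= z -> f y * (z / y) <= f z.
Proof.
move=> y1 yz; rewrite (le_trans _ (growth y1 yz))// ler_wpM2l//.
have y0 : 0 < y by rewrite (lt_le_trans ltr01).
by rewrite ler_eXnr// ler_pdivlMr// mul1r.
Qed.

Lemma integral_image_measure (l a : R) (D : set R) : measurable D ->
  (\int[image_measure f]_(y in D) (expR (- l * (y - a)))%:E =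
   \int[mu]_(z in [set z | (0 < z)%R /\ D (f z)]) (expR (- (l * (f z -
     a))))%:E)%E.
Proof.
move=> mD.
have mfD : measurable (f @^-1` D) by rewrite -[X in measurable X]setTI;
  exact: mf.
rewrite ge0_integral_pushforward//; last first.
  apply: (@measurable_funS _ _ _ _ setT) => //.
  apply/measurable_EFinP; apply: measurableT_comp => //.
  by apply: measurable_funM => //; exact: measurable_funB.
rewrite integral_mrestr//.
- rewrite (_ : _ `&` _ = [set z | 0 < z /\ D (f z)]); last first.
    by apply/seteqP; split=> z /=; rewrite !in_itv/= !andbT => -[].
  by apply: eq_integral => z _ /=; rewrite mulNr.
- rewrite [X in measurable_fun _ X](_ : _ = (fun z =>
  (expR (- (l * (f z - a))))%:E)).
    exact: measurable_discount.
  by apply/funext => z /=; rewrite mulNr.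
- by move=> z; rewrite lee_fin expR_ge0.
Qed.

Lemma integral_image_measure0 (l : R) : (forall z, 0 < z -> 0 < f z) ->
  (\int[image_measure f]_(y in `]0%R, +oo[) (expR (- l * y))%:E = laplace l)%E.
Proof.
move=> f_gt0.
transitivity (\int[image_measure f]_(y in `]0%R, +oo[) (expR (- l * (y -
  0)))%:E)%E.
  by congr integral; apply/funext => y; rewrite subr0.
rewrite integral_image_measure// /laplace.
rewrite (_ : [set z | 0 < z /\ _] = `]0, +oo[%classic); last first.
  apply/seteqP; split=> z /=; rewrite !in_itv/= !andbT; first by case.
  by move=> z0; split=> //; exact: f_gt0.
rewrite -integral_itv_obnd_cbnd; last exact: measurable_laplace.
by apply: eq_integral => z _; rewrite subr0.
Qed.

(** Only [[0, 2]] is kept. The bound exceeds 1 when [l * f 2 < ln 2], which later bounds the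
    Malthusian parameter from below. *)
Lemma laplace_ge (l : R) : 0 <= l -> ((2 * expR (- (l * f 2)))%:E <= laplace
  l)%E.
Proof.
move=> l0; rewrite /laplace.
apply: (@le_trans _ _ (\int[mu]_(z in `[0%R, 2%R]) (expR (- (l * f 2)))%:E)%E).
  rewrite integral_cst//= lebesgue_measure_itv/= lte_fin ltr0n/= -EFinB subr0.
  by rewrite -EFinM lee_fin mulrC.
apply: (@le_trans _ _ (\int[mu]_(z in `[0%R, 2%R]) (expR (- (l * f z)))%:E)%E).
  apply: ge0_le_integral => //; first exact: measurable_laplace.
  - move=> z /=; rewrite in_itv/= => /andP[_ z2].
    by rewrite lee_fin ler_expR lerN2 ler_wpM2l// ndf.
apply: ge0_subset_integral => //; first exact: measurable_laplace.
by move=> z /=; rewrite !in_itv/= andbT => /andP[].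
Qed.

(** On [[0, p[] the integrand is at most 1, on [[p, 1[] it is bounded by its value at [p], and
    beyond 1 Bernoulli turns the power growth of [f] into an exponential tail of rate
    [l * f 1 * N]. *)
Lemma laplace_le (l p k : R) : 0 < l -> 0 <= p -> p <= 1 -> k * f 1 <= f p ->
  (laplace l <= (p + (1 - p) * expR (- (l * f 1 * k)) +
    expR (- (l * f 1)) / (l * f 1 * N%:R))%:E)%E.
Proof.
move=> l0 p0 p1 kp; rewrite /laplace.
have b0 : 0 < l * f 1 by rewrite mulr_gt0.
have exp0 (D : set R) z : D z -> (0 <= (expR (- (l * f z)))%:E :> \bar R)%E.
  by move=> _; rewrite lee_fin expR_ge0.
have -> : `[0, +oo[%classic = `[0, p[%classic `|` (`[p, 1[%classic `|` `[1%R,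
  +oo[%classic) :> set R.
  apply/seteqP; split=> z /=; rewrite !in_itv/= ?andbT.
    move=> z0; case: (ltP z p) => zp; first by left; rewrite z0.
    by right; case: (ltP z 1) => z1; [left; apply/andP|right].
  by move=> [/andP[]//|[/andP[pz _]|z1]]; lra.
rewrite ge0_integral_setU//; last 3 first.
- exact: measurableU.
- exact: measurable_laplace.
- apply/disj_set2P/seteqP; split=> z //= [] ; rewrite !in_itv/= !andbT =>
  /andP[_ zp].
  by move=> [/andP[pz _]|z1]; lra.
rewrite ge0_integral_setU//; last 2 first.
- exact: measurable_laplace.
- by apply/disj_set2P/seteqP; split=> z //= [];
  rewrite !in_itv/= !andbT => /andP[_ zp] z1; lra.
rewrite -[X in (_ <= X%:E)%E]addrA EFinD; apply: leeD.
  apply: (@le_trans _ _ (\int[mu]_(z in `[0%R, p[) 1)%E).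
    apply: ge0_le_integral => //; first exact: measurable_laplace.
    by move=> z _; rewrite lee_fin expR_le1 oppr_le0 mulr_ge0// ltW.
  rewrite integral_cst//= mul1e lebesgue_measure_itv/= lte_fin.
  case: ifP => _; last by rewrite lee_fin.
  by rewrite -EFinB subr0.
rewrite EFinD; apply: leeD.
  apply: (@le_trans _ _ (\int[mu]_(z in `[p, 1%R[) (expR (- (l * f 1 *
    k)))%:E)%E).
    apply: ge0_le_integral => //; first exact: measurable_laplace.
    - move=> z /=; rewrite in_itv/= => /andP[pz _].
      rewrite lee_fin ler_expR lerN2 -mulrA ler_pM2l// mulrC (le_trans kp)//.
      exact: ndf.
  rewrite integral_cst//= lebesgue_measure_itv/= lte_fin.
  have [_|p1'] := ltP p 1; first by rewrite -EFinB -EFinM lee_fin mulrC.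
  rewrite mule0 lee_fin mulr_ge0 ?expR_ge0//; lra.
have mtail (D : set R) : measurable_fun D (fun z =>
  (expR (- (l * f 1 * N%:R * z)))%:E).
  apply: (@measurable_funS _ _ _ _ setT) => //.
  apply/measurable_EFinP; apply: measurableT_comp => //.
  by apply: measurableT_comp => //; exact: measurable_funM.
have bN : 0 < l * f 1 * N%:R by rewrite mulr_gt0// ltr0n.
apply: (@le_trans _ _ (\int[mu]_(z in `[1%R, +oo[) ((expR (l * f 1 * (N%:R -
  1)))%:E * (expR (- (l * f 1 * N%:R * z)))%:E))%E).
  apply: ge0_le_integral => //.
  - exact: measurable_laplace.
  - by apply: measurable_funeM; exact: mtail.
  - move=> z /=; rewrite in_itv/= andbT => z1.
    rewrite -EFinM lee_fin -expRD ler_expR.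
    have h := growth (lexx 1) z1; rewrite divr1 in h.
    have hb : 1 + N%:R * (z - 1) <= z ^+ N.
      have := @bernoulli_ge _ (z - 1) N; rewrite (addrC 1 (z - 1)) subrK.
      by rewrite -[(z - 1) *+ _]mulr_natr (mulrC (z - 1)) addrC; apply; lra.
    have h2 : f 1 * (1 + N%:R * (z - 1)) <= f z.
      by rewrite (le_trans _ h)// ler_pM2l.
    have : l * (f 1 * (1 + N%:R * (z - 1))) <= l * f z by rewrite ler_pM2l.
    lra.
rewrite ge0_integralZl//; last exact: mtail.
rewrite integral_exponential_tail// -EFinM lee_fin mulrA -expRD.
rewrite (_ : _ + - _ = - (l * f 1))//; ring.
Qed.

End discounted_weight.

(** * Existence and size of the Malthusian parameter *)

Section malthusian.
Context {R : realType} (f : R -> R) (N : nat).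
Hypotheses (f_ge0 : forall z, 0 <= f z) (f_gt0 : forall z, 0 < z -> 0 < f z)
  (ndf : {homo f : a b / a <= b})
  (f1_gt0 : 0 < f 1) (N_gt0 : (0 < N)%N)
  (growth : forall y z, 1 <= y -> y <= z -> f y * (z / y) ^+ N <= f z).

Let mu := @lebesgue_measure R.

Let f2_gt0 : 0 < f 2.
Proof. by rewrite (lt_le_trans f1_gt0)// ndf// ler1n. Qed.

Let ln2_gt0 : 0 < ln 2 :> R.
Proof. by rewrite ln_gt0// ltr1n. Qed.

Lemma laplace_lty (l : R) : 0 < l -> (laplace f l < +oo)%E.
Proof.
move=> l0; have := @laplace_le _ f N f_ge0 ndf f1_gt0 N_gt0 growth l 0 0 l0.
by rewrite mul0r => /(_ _ _ _)/le_lt_trans; apply; rewrite ?ltry.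
Qed.

Lemma laplace_ge0 (l : R) : (0 <= laplace f l)%E.
Proof. by apply: integral_ge0 => z _; rewrite lee_fin expR_ge0. Qed.

Lemma laplace_antitone (l l' : R) : l <= l' -> (laplace f l' <= laplace f l)%E.
Proof.
move=> ll'; apply: ge0_le_integral => //.
- exact: measurable_laplace.
- exact: measurable_laplace.
- by move=> z _; rewrite lee_fin ler_expR lerN2 ler_wpM2r.
Qed.

Lemma laplace_integrable (l : R) : 0 < l ->
  mu.-integrable `[0, +oo[ (EFin \o (fun z => expR (- (l * f z)))).
Proof.
move=> l0; apply/integrableP; split; first exact: measurable_laplace.
rewrite (le_lt_trans _ (laplace_lty l0))// le_eqVlt; apply/orP; left; apply/eqP.
by apply: eq_integral => z _; rewrite /= ger0_norm// expR_ge0.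
Qed.

Lemma laplace_continuous (u v : R) : 0 < u ->
  {in `]u, v[, continuous (fun l => fine (laplace f l))}.
Proof.
move=> u0 l luv.
apply: (@continuity_under_integral _ _ _ mu (fun l z => expR (- (l * f z)))
  `[0, +oo[%classic _ u v _ _ (fun z => expR (- (u * f z)))) => //.
- by move=> x; rewrite /= in_itv/= => /andP[ux _];
  apply/laplace_integrable/lt_trans/ux.
- apply: aeW => z _ x _.
  apply: continuous_comp; last exact: continuous_expR.
  apply: continuousN; apply: continuousM; first exact: cvg_id.
  exact: cst_continuous.
- exact: laplace_integrable.
- move=> x; rewrite /= in_itv/= => /andP[ux _]; apply: aeW => z _.
  by rewrite ger0_norm ?expR_ge0// ler_expR lerN2 ler_wpM2r// ltW.
- by rewrite inE.
Qed.

Variable C : R.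
Hypotheses (C_gt0 : 0 < C) (laplace_C : (laplace f (C / f 1) < 1)%E).

Lemma laplace_lt1_gt (l : R) : 0 <= l -> l * f 2 < ln 2 -> (1 < laplace f l)%E.
Proof.
move=> l0 lf; apply: lt_le_trans (laplace_ge ndf l0).
rewrite lte_fin -[X in X < _](mulfV (_ : 2 != 0 :> R))// ltr_pM2l//.
by rewrite -[X in X < _]lnK ?posrE// ltr_expR lnV ?posrE// ltrN2.
Qed.

(** Intermediate values between [ln 2 / f 2], where [laplace_ge] gives at least 1, and [C / f 1],
    where the transform is below 1. *)
Lemma malthusian_exists : exists2 l : R, 0 < l & laplace f l = 1%E.
Proof.
pose a := ln 2 / f 2; pose b := C / f 1.
have a0 : 0 < a by rewrite divr_gt0.
have b0 : 0 < b by rewrite divr_gt0.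
have lf (l : R) : 0 < l -> laplace f l = (fine (laplace f l))%:E.
  by move=> l0; rewrite fineK// ge0_fin_numE ?laplace_lty// laplace_ge0.
have La : (1 <= laplace f a)%E.
  apply: le_trans (laplace_ge ndf (ltW a0)).
  by rewrite lee_fin /a divfK ?gt_eqF// expRN lnK ?posrE// mulfV.
have ab : a <= b.
  rewrite leNgt; apply/negP => /ltW/laplace_antitone.
  by move=> /(le_trans La)/le_lt_trans/(_ laplace_C); rewrite ltxx.
have cF : {within `[a, b], continuous (fun l => fine (laplace f l))}.
  apply: continuous_in_subspaceT => l /set_mem /=;
    rewrite in_itv/= => /andP[al lb].
  apply: (@laplace_continuous (a / 2) (b + 1)); first by rewrite divr_gt0.
  have h1 : a / 2 < l by lra.
  have h2 : l < b + 1 by lra.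
  by rewrite inE; apply/andP; split; rewrite bnd_simp.
have [|l lab l1] := @IVT R (fun l => fine (laplace f l)) a b 1 ab cF.
  apply/andP; split.
    rewrite ge_min; apply/orP; right; rewrite -lee_fin -lf//; exact: ltW.
  by rewrite le_max; apply/orP; left; rewrite -lee_fin -lf.
have l0 : 0 < l by rewrite (lt_le_trans a0)// (itvP lab).
by exists l => //; rewrite lf// l1.
Qed.

(** [laplace] is antitone, so every positive root satisfies both bounds, in particular the one that
    [xget] selects. *)
Lemma malthusianP : [/\ 0 < malthusian f, malthusian f * f 1 <= C &
  ln 2 <= malthusian f * f 2].
Proof.
have [l l0 l1] := malthusian_exists.
have [m0 m1] : 0 < malthusian f /\ laplace f (malthusian f) = 1%E.
  rewrite /malthusian; case: xgetP => [_ -> [h0 h1]|/(_ l) []].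
    by split=> //; rewrite -integral_image_measure0.
  by split=> //; rewrite integral_image_measure0.
split=> //.
  rewrite -ler_pdivlMr// leNgt; apply/negP => /ltW/laplace_antitone.
  by rewrite m1 => /le_lt_trans/(_ laplace_C); rewrite ltxx.
by rewrite leNgt; apply/negP => /(laplace_lt1_gt (ltW m0)); rewrite m1 ltxx.
Qed.

End malthusian.

Section freezing_weight_bounds.
Context {R : realType} (f : R -> R) (N : nat).
Hypotheses (f_ge0 : forall z, 0 <= f z) (ndf : {homo f : a b / a <= b})
  (f1_gt0 : 0 < f 1) (N_gt0 : (0 < N)%N)
  (growth : forall y z, 1 <= y -> y <= z -> f y * (z / y) ^+ N <= f z).

Let mu := @lebesgue_measure R.

(** On []p, 1[] one has [a <= f z] and [l * (f z - a) <= l * f 1 <= C]. It is used with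
    [p = exp (- 1 / S)], whose distance to 1 is of order [1 / S]. *)
Lemma discounted_weight_ge (l C a p : R) : 0 <= l -> l * f 1 <= C -> 0 <= a ->
  a <= f p -> 0 <= p -> p <= 1 ->
  ((expR (- C) * (1 - p))%:E <=
    \int[image_measure f]_(y in `[a, +oo[) (expR (- l * (y - a)))%:E)%E.
Proof.
move=> l0 lC a0 afp p0 p1; rewrite integral_image_measure//.
apply: (@le_trans _ _ (\int[mu]_(z in `]p, 1%R[) (expR (- C))%:E)%E).
  rewrite integral_cst//= lebesgue_measure_itv/= lte_fin.
  have [_|p1'] := ltP p 1; first by rewrite -EFinB -EFinM.
  by rewrite mule0 lee_fin (_ : p = 1) ?subrr ?mulr0//; apply/eqP;
    rewrite eq_le p1.
have hD z : `]p, 1[%classic z -> 0 < z /\ (a <= f z).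
  rewrite /= in_itv/= => /andP[pz _]; split; first exact: le_lt_trans pz.
  by rewrite (le_trans afp)// ndf// ltW.
apply: (@le_trans _ _ (\int[mu]_(z in `]p, 1%R[) (expR (- (l * (f z -
  a))))%:E)%E).
  apply: ge0_le_integral => //; first exact: measurable_discount.
  move=> z /=; rewrite in_itv/= => /andP[_ z1]; rewrite lee_fin ler_expR lerN2.
  rewrite (le_trans _ lC)// ler_wpM2l// (le_trans _ (ndf (ltW z1)))//; lra.
apply: ge0_subset_integral => //.
- have mf : measurable_fun setT f by exact: nondecreasing_measurable.
  rewrite (_ : [set z | _] = `]0, +oo[%classic `&` f @^-1` `[a, +oo[).
    by apply: measurableI => //; rewrite -[X in measurable X]setTI; exact: mf.
  by apply/seteqP; split=> z /=; rewrite !in_itv/= !andbT.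
- exact: measurable_discount.
- by move=> z /hD[z0 az]; split=> //=; rewrite in_itv/= az.
Qed.

(** Below [2 * r] the integrand is at most 1. Beyond, [f z >= 2 * f r >= 2 * a], hence [l * (f z -
    a) >= l * f z / 2 >= ln 2 / 4 * z], a tail bound independent of [f]. *)
Lemma discounted_weight_le (l a r : R) : 0 < l -> ln 2 <= l * f 2 ->
  1 <= r -> a <= f r ->
  (\int[image_measure f]_(y in `[a, +oo[) (expR (- l * (y - a)))%:E
    <= (2 * r + 4 / ln 2)%:E)%E.
Proof.
move=> l0 lf2 r1 afr; rewrite integral_image_measure//.
have ln2_gt0 : 0 < ln 2 :> R by rewrite ln_gt0// ltr1n.
set D := [set z | _].
have mD : measurable D.
  have mf : measurable_fun setT f by exact: nondecreasing_measurable.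
  rewrite (_ : D = `]0, +oo[%classic `&` f @^-1` `[a, +oo[).
    by apply: measurableI => //; rewrite -[X in measurable X]setTI; exact: mf.
  by rewrite /D; apply/seteqP; split=> z /=; rewrite !in_itv/= !andbT.
have DE : D = (D `&` `[0, 2 * r[%classic) `|` (D `&` `[2 * r, +oo[%classic).
  apply/seteqP; split=> z; last by move=> [[]|[]].
  move=> Dz; have z0 : 0 < z by case: Dz.
  case: (ltP z (2 * r)) => zr; [left|right]; split=> //=; rewrite in_itv/=.
    by rewrite (ltW z0).
  by rewrite zr.
rewrite DE ge0_integral_setU//; last 4 first.
- exact: measurableI.
- exact: measurableI.
- exact: measurable_discount.
- apply/disj_set2P/seteqP; split=> z // [[_ /itvP h1] [_ /itvP h2]].
  have zr : z < 2 * r by rewrite h1.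
  have rz : 2 * r <= z by rewrite h2.
  lra.
rewrite EFinD; apply: leeD.
  apply: (@le_trans _ _ (\int[mu]_(z in D `&` `[0%R, (2 * r)%R[) 1)%E).
    apply: ge0_le_integral => //; first exact: measurableI.
    - exact: measurable_discount.
    - move=> z [[_ /=]]; rewrite in_itv/= andbT => az _.
      by rewrite lee_fin expR_le1 oppr_le0 mulr_ge0 ?subr_ge0// ltW.
  apply: (@le_trans _ _ (\int[mu]_(z in `[0%R, (2 * r)%R[) 1)%E).
    apply: ge0_subset_integral => //; exact: measurableI.
  rewrite integral_cst//= mul1e lebesgue_measure_itv/= lte_fin.
  case: ifP => _; first by rewrite -EFinB subr0.
  by rewrite lee_fin; lra.
have mtail (E : set R) : measurable_fun E (fun z =>
  (expR (- (ln 2 / 4 * z)))%:E).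
  apply: (@measurable_funS _ _ _ _ setT) => //.
  apply/measurable_EFinP; apply: measurableT_comp => //.
  by apply: measurableT_comp => //; exact: measurable_funM.
apply: (@le_trans _ _ (\int[mu]_(z in D `&` `[(2 * r)%R, +oo[) (expR (- (ln 2 /
  4 * z)))%:E)%E).
  apply: ge0_le_integral => //; first exact: measurableI.
  - exact: measurable_discount.
  - exact: mtail.
  - move=> z [_ /=]; rewrite in_itv/= andbT => rz.
    rewrite lee_fin ler_expR lerN2.
    have h1 : f r * 2 <= f z.
      rewrite (le_trans _ (linear_growth f_ge0 N_gt0 growth r1 (_ : r <= z)))//;
        last lra.
      by rewrite ler_wpM2l// ler_pdivlMr//; lra.
    have h2 : f 2 * (z / 2) <= f z.
      by apply: (linear_growth f_ge0 N_gt0 growth); lra.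
    have h3 : l * (f 2 * (z / 2)) <= l * f z by rewrite ler_pM2l.
    have h4 : ln 2 * (z / 2) <= l * f 2 * (z / 2) by rewrite ler_wpM2r//; lra.
    have h5 : l * (f z / 2) <= l * (f z - a) by rewrite ler_pM2l//; lra.
    lra.
apply: (@le_trans _ _ (\int[mu]_(z in `[(2 * r)%R, +oo[) (expR (- (ln 2 / 4 *
  z)))%:E)%E).
  by apply: ge0_subset_integral => //; [exact: measurableI|exact: mtail].
rewrite integral_exponential_tail ?divr_gt0// lee_fin invf_div.
apply: ler_piMl; first by rewrite divr_ge0// ltW.
rewrite expR_le1 oppr_le0 mulr_ge0//; last lra.
by rewrite divr_ge0// ltW.
Qed.

Lemma freezing_weight_ge (x : vertex -> R) (w : R) (t : R) (s : seq vertex) :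
  uniq s -> (forall v, v \in s -> birth_time f x v <= t /\
    (w%:E <= \int[image_measure f]_(y in `[(t - birth_time f x v)%R, +oo[)
      (expR (- malthusian f * (y - (t - birth_time f x v))))%:E)%E) ->
  (((size s)%:R * w)%:E <= freezing_weight f x t)%E.
Proof.
move=> us hs; rewrite /freezing_weight; apply: esum_ge; exists [set` s].
  by split; [exact: finite_seq|move=> v /= /hs[]].
rewrite -fsbig_seq//.
apply: (@le_trans _ _ (\sum_(v <- s) w%:E)%E).
  by rewrite sumEFin big_const_seq count_predT iter_addr_0 mulr_natl.
by rewrite big_seq [leRHS]big_seq; apply: lee_sum => v /hs[].
Qed.

Lemma freezing_weight_le (x : vertex -> R) (w : R) (t : R) (s : seq vertex) :
  0 <= w -> (forall v, birth_time f x v <= t -> v \in s /\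
    (\int[image_measure f]_(y in `[(t - birth_time f x v)%R, +oo[)
      (expR (- malthusian f * (y - (t - birth_time f x v))))%:E <= w%:E)%E) ->
  (freezing_weight f x t <= ((size s)%:R * w)%:E)%E.
Proof.
move=> w0 hs; apply: ge_ereal_sup => _ [A [finA At] <-].
rewrite fsbig_finite//.
apply: (@le_trans _ _ (\sum_(v <- finmap.enum_fset (fset_set A)) w%:E)%E).
  rewrite big_seq [leRHS]big_seq; apply: lee_sum => v.
  by rewrite in_fset_set// => /set_mem /At /hs[].
rewrite sumEFin big_const_seq count_predT iter_addr_0 lee_fin -[w *+
  _]mulr_natl.
rewrite ler_wpM2r// ler_nat; apply: uniq_leq_size;
  first exact: finmap.fset_uniq.
by move=> v; rewrite in_fset_set// => /set_mem /At /hs[].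
Qed.

End freezing_weight_bounds.

(** * Bounds on the freezing time *)

Section freezing_time_bounds.
Context {R : realType} (f : R -> R).
Hypotheses (f_ge0 : forall z, 0 <= f z)
  (f_mono : forall y z, 0 < y -> y < z -> f y < f z).

Lemma edge_fun_inv_le (T : \bar R) r : 0 < r -> (T <= (f r)%:E)%E ->
  (edge_fun_inv f T <= r%:E)%E.
Proof.
move=> r0 Tr; apply: ge_ereal_sup => _ [->|[z [z0 fz] <-]].
  by rewrite lee_fin ltW.
rewrite lee_fin leNgt; apply/negP => /(f_mono r0).
by rewrite -lte_fin => /(le_lt_trans Tr)/(le_lt_trans fz); rewrite ltxx.
Qed.

Lemma edge_fun_inv_ge (T : \bar R) r : 0 < r -> ((f r)%:E <= T)%E ->
  (r%:E <= edge_fun_inv f T)%E.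
Proof. by move=> r0 Tr; apply: ereal_sup_ubound; right; exists r. Qed.

Lemma edge_fun_inv_ge0 (T : \bar R) : (0 <= edge_fun_inv f T)%E.
Proof. by apply: ereal_sup_ubound; left. Qed.

Lemma freezing_time_ge (x : vertex -> R) (S r w : R) (l : seq vertex) :
  0 <= w -> (size l)%:R * w < S ->
  (forall t v, t <= f r -> birth_time f x v <= t -> v \in l /\
    (\int[image_measure f]_(y in `[(t - birth_time f x v)%R, +oo[)
      (expR (- malthusian f * (y - (t - birth_time f x v))))%:E <= w%:E)%E) ->
  ((f r)%:E <= freezing_time f S x)%E.
Proof.
move=> w0 lS hl; apply: le_ereal_inf_tmp => _ [t [t0 St] <-].
rewrite lee_fin leNgt; apply/negP => /ltW tr.
have := le_trans St (freezing_weight_le w0 (fun v => hl t v tr)).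
by rewrite lee_fin leNgt lS.
Qed.

(* Cut [0, t0] into windows of length [h]: one of them contains enough births to
   freeze the process by the end of the window. *)
Lemma freezing_time_le (x : vertex -> R) (S t0 h w : R) (s : seq vertex) :
  uniq s -> 0 < h -> 0 <= t0 -> (forall v, v \in s -> birth_time f x v <= t0) ->
  (forall a, 0 <= a -> a <= h ->
    (w%:E <= \int[image_measure f]_(y in `[a, +oo[)
      (expR (- malthusian f * (y - a)))%:E)%E) ->
  (t0 / h + 1) * S <= (size s)%:R * w -> 0 <= S ->
  (freezing_time f S x <= (t0 + h)%:E)%E.
Proof.
move=> us h0 t00 st0 hw hS S0.
pose bin v := Num.truncn (birth_time f x v / h).
pose W := (Num.truncn (t0 / h)).+1.
have bq v : 0 <= birth_time f x v / h by rewrite divr_ge0 ?birth_time_ge0// ltW.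
have t0h : 0 <= t0 / h by rewrite divr_ge0// ltW.
have binW v : v \in s -> (bin v < W)%N.
  by move=> vs; rewrite ltnS le_truncn// ler_pM2r ?invr_gt0// st0.
have [i iW hi] : exists2 i : nat, (i < W)%N & S <= (count (fun v =>
  bin v == i) s)%:R * w.
  apply: contrapT => hn.
  have {}hn (i : 'I_W) : (count (fun v => bin v == i) s)%:R * w < S.
    by rewrite ltNge; apply/negP => hi; apply: hn; exists i.
  have sumE : (size s)%:R = \sum_(i < W) (count (fun v =>
    bin v == i) s)%:R :> R.
    rewrite -natr_sum; congr (_%:R).
    have : all (fun v => bin v < W)%N s by apply/allP.
    elim: (s) => [|v s' IH] /=; first by rewrite big1.
    move=> /andP[vW /IH ->]; rewrite big_split /= -[LHS]add1n; congr addn.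
    rewrite (bigD1 (Ordinal vW))//= eqxx big1 ?addn0// => j jv.
    by apply/eqP; rewrite eqb0 eq_sym -val_eqE in jv *.
  move: hS; rewrite sumE mulr_suml leNgt => /negP; apply.
  have WS : W%:R * S <= (t0 / h + 1) * S.
    by rewrite ler_wpM2r// /W -natr1 lerD2r truncn_le.
  apply: lt_le_trans WS; rewrite mulr_natl -[X in _ *+ X]card_ord -sumr_const.
  by apply: ltr_sum => //; apply/hasP; exists (Ordinal (ltn0Sn _)) => //;
    rewrite mem_index_enum.
pose t := i.+1%:R * h.
have iT : t <= t0 + h.
  rewrite /t -natr1 mulrDl mul1r lerD2r -ler_pdivlMr//.
  apply: (@le_trans _ _ (Num.truncn (t0 / h))%:R); last by rewrite truncn_le.
  by rewrite ler_nat -ltnS.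
apply: (@le_trans _ _ t%:E); last by rewrite lee_fin.
apply: ereal_inf_lbound; exists t => //; split; first by rewrite mulr_ge0// ltW.
pose s' := [seq v <- s | bin v == i].
apply: (@le_trans _ _ ((size s')%:R * w)%:E); first by rewrite lee_fin
  size_filter.
apply: freezing_weight_ge; first exact: filter_uniq.
move=> v; rewrite mem_filter => /andP[/eqP vi vs].
have vt : birth_time f x v <= t.
  by rewrite /t -ler_pdivrMr// ltW// -vi truncnS_gt.
split=> //; apply: hw; first by rewrite subr_ge0.
rewrite lerBlDr /t -natr1 mulrDl mul1r addrC lerD2l -ler_pdivlMr// -vi.
by rewrite truncn_le.
Qed.

End freezing_time_bounds.

(* What is used of [f = f_n] and [S = s_n] for large [n]: beyond [1] the growth
   exponent of [f] is at least of order [S], on the scale [1 + O(1 / S)] around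
   [1] the function [f] stays comparable to [f 1], and so does [1 / lambda_n].
     *)
Record regular_weight (R : realType) (f : R -> R) (S eps kappa C : R) : Prop :=
  RegularWeight {
    regular_ge0 : forall z, 0 <= f z;
    regular_gt0 : forall z, 0 < z -> 0 < f z;
    regular_nondecreasing : {homo f : a b / a <= b};
    regular_increasing : forall y z, 0 < y -> y < z -> f y < f z;
    regular_growth : forall y z, 1 <= y -> y <= z ->
      f y * (z / y) ^+ Num.truncn (eps * S) <= f z;
    regular_low : kappa * f 1 <= f (expR (- S^-1));
    regular_high : kappa * f (expR S^-1) <= f 1;
    regular_malthusian_gt0 : 0 < malthusian f;
    regular_malthusian_le : malthusian f * f 1 <= C;
    regular_malthusian_ge : ln 2 <= malthusian f * f 2 }.

(** * Deterministic upper bound on the freezing time *)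

Section deterministic_bounds.
Context {R : realType}.
Implicit Types (f : R -> R) (S r : R).

Lemma expR_inv_gap S : 0 < S -> (S + 1)^-1 <= 1 - expR (- S^-1).
Proof.
move=> S0; have Si : 0 < S^-1 by rewrite invr_gt0.
have := offspring_survival_inv ltr01 Si.
have := offspring_survival_gt0 ltr01 Si.
rewrite /offspring_survival !mul1r invrK => h0 h1.
by rewrite -[leRHS]invrK lef_pV2 ?posrE ?invr_gt0//; lra.
Qed.

Lemma critical_level_le S : 0 < S ->
  expR S^-1 / (expR S^-1 - 1) <= (Num.truncn S).+1%:R + 3.
Proof.
move=> S0; have Si : 0 < S^-1 by rewrite invr_gt0.
have e1 : 1 < expR S^-1 by rewrite expR_gt1.
have gap := expR_inv_gap S0.
have gap0 : 0 < 1 - expR (- S^-1) by rewrite (lt_le_trans _ gap)// invr_gt0;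
  lra.
have -> : expR S^-1 / (expR S^-1 - 1) = (1 - expR (- S^-1))^-1.
  by rewrite expRN; field; rewrite !subr_eq0; lra.
have : (1 - expR (- S^-1))^-1 <= S + 1.
  by rewrite -[leRHS]invrK lef_pV2 ?posrE ?invr_gt0//; lra.
by have := truncnS_gt S; lra.
Qed.

Lemma cube_le_expR (z : R) : 0 <= z -> z ^+ 3 / 6 <= expR z.
Proof.
move=> z0; rewrite (le_trans _ (expR_ge1Dxn 2 z0))//.
by rewrite (_ : 3`! = 6)%N//; lra.
Qed.

Lemma sextic_le_expR : exists2 q : R, 0 < q &
  forall z : R, 0 <= z -> z ^+ 6 <= q * expR z.
Proof.
exists (6`!)%:R => [|z z0]; first by rewrite ltr0n fact_gt0.
have q0 : 0 < (6`!)%:R :> R by rewrite ltr0n fact_gt0.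
rewrite mulrC -ler_pdivrMr//.
by rewrite (le_trans _ (expR_ge1Dxn 5 z0))// lerDr.
Qed.

(** The exponent is at least [eps * S / 2], so the power is exponential in [S] and dominates a cube.
    The constant 48 is 6 from [cube_le_expR] times 8 from the halving. *)
Lemma geometric_growth_ge (a c eps : R) : 1 < a -> 0 < eps -> exists K0 : R,
  forall S, K0 <= S -> c * S ^+ 2 <= a ^+ Num.truncn (eps * S).
Proof.
move=> a1 eps0; have th0 : 0 < ln a by rewrite ln_gt0.
have a0 : 0 < a by rewrite (lt_trans ltr01).
have et0 : 0 < (eps * ln a) ^+ 3 by rewrite exprn_gt0// mulr_gt0.
exists (2 / eps + 48 * `|c| / (eps * ln a) ^+ 3) => S hS.
have q1 : 0 < 2 / eps by rewrite divr_gt0.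
have q2 : 0 <= 48 * `|c| / (eps * ln a) ^+ 3 by rewrite divr_ge0 ?mulr_ge0//
  ltW.
have S0 : 0 < S by lra.
have S1 : 2 <= eps * S by rewrite mulrC -ler_pdivrMr//; lra.
have S2 : 48 * `|c| <= (eps * ln a) ^+ 3 * S.
  by rewrite [leRHS]mulrC -ler_pdivrMr//; lra.
set N := Num.truncn _; have hN : eps * S / 2 <= N%:R.
  by have := truncnS_gt (eps * S); rewrite -/N -natr1; lra.
have z0 : 0 <= N%:R * ln a by rewrite mulr_ge0// ltW.
rewrite -[a in leRHS]lnK ?posrE// -expRM_natl (le_trans _ (cube_le_expR z0))//.
have h1 : (eps * S / 2 * ln a) ^+ 3 <= (N%:R * ln a) ^+ 3.
  rewrite lerXn2r ?nnegrE//; first by rewrite !mulr_ge0// ltW.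
  by rewrite ler_pM2r.
have h2 : c * S ^+ 2 <= `|c| * S ^+ 2 by rewrite ler_wpM2r ?exprn_ge0
  ?ler_norm// ltW.
have h3 : 48 * `|c| * S ^+ 2 <= (eps * ln a) ^+ 3 * S * S ^+ 2.
  by rewrite ler_wpM2r ?exprn_ge0// ltW.
have e1 : (eps * S / 2 * ln a) ^+ 3 = (eps * ln a) ^+ 3 * S * S ^+ 2 / 8
  by field.
rewrite e1 in h1; lra.
Qed.

Lemma freezing_time_upper (r delta eps kappa C : R) :
  1 < r -> 0 < delta -> 0 < eps -> 0 < kappa -> kappa <= 1 ->
  exists K0 : R, forall f S, K0 <= S -> regular_weight f S eps kappa C ->
    let k := ((Num.truncn S).+1 * (Num.truncn S).+1 + (Num.truncn S).+1)%N in
    exists l L : nat, [/\ (0 < L)%N, L%:R <= expR S^-1 ^+ l &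
      forall x, locally_finite x ->
        (L < size (generation x (two_levels r (expR S^-1) k) (k + l)))%N ->
        (freezing_time f S x <= (f (r + delta))%:E)%E].
Proof.
move=> r1 d0 eps0 kap0 kap1; have r0 : 0 < r by rewrite (lt_trans ltr01).
(* [c3] bounds [f y / f 1], [c4] the number of windows over [S ^ 2 * B], and [c5] the end of the
   last window over [S ^ 2 * f r]. *)
pose c3 := kappa^-1; have c30 : 1 <= c3 by rewrite /c3 invf_ge1.
pose c4 := (6 + 2 * c3) * c3 + 1.
pose c5 := 6 + 4 * c3 + 1.
have a1 : 1 < (r + delta) / r by rewrite ltr_pdivlMr// mul1r ltrDl.
have [K1 hK1] := geometric_growth_ge c5 a1 eps0.
have c40 : 0 < c4 by rewrite /c4 addr_gt0// mulr_gt0; lra.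
have eC := expR_gt0 C.
have [q q0 hq] := sextic_le_expR.
have K20 : 0 <= 2 * q * (c4 * expR C).
  by rewrite !mulr_ge0 ?expR_ge0// ltW.
exists (1 + `|K1| + 2 * q * (c4 * expR C)) => f S hS hf k.
have S1 : 1 <= S by have := normr_ge0 K1; lra.
have SK1 : K1 <= S by have := ler_norm K1; lra.
have SK2 : 2 * q * (c4 * expR C) <= S by have := normr_ge0 K1; lra.
have S0 : 0 < S by lra.
set M := (Num.truncn S).+1 in k *; set y := expR S^-1.
have f1 : 0 < f 1 by exact: regular_gt0 hf _ ltr01.
have fr1 : f 1 <= f r by apply: (regular_nondecreasing hf); exact: ltW.
have fr0 : 0 < f r by lra.
pose A := f r / f 1; have A1 : 1 <= A by rewrite /A ler_pdivlMr// mul1r.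
have frE : f r = A * f 1 by rewrite /A divfK ?gt_eqF.
pose B := A + S; have B0 : 0 <= B by rewrite /B; lra.
(* Rounding [l] up and [L] down gives [L <= exp B <= y ^+ l], while a size above [L] still exceeds
   [exp B]. *)
pose l := (Num.truncn (S * B)).+1; pose L := Num.truncn (expR B).
have y0 : 0 < y by exact: expR_gt0.
have SB1 : 1 <= S * B by rewrite -[1]mulr1 ler_pM//; rewrite /B; lra.
have fyc : f y <= c3 * f 1.
  by rewrite /c3 mulrC ler_pdivlMr// mulrC; exact: regular_high hf.
have fy0 : 0 <= f y by exact: regular_ge0 hf _.
have kS : k%:R <= 6 * S ^+ 2.
  have MS : M%:R <= 2 * S.
    by rewrite /M -natr1; have := truncn_le S; rewrite (ltW S0); lra.
  have M0 : 0 <= M%:R :> R by [].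
  rewrite /k natrD natrM; nra.
have lS : l%:R <= 2 * (S * B).
  by rewrite /l -natr1; have := truncn_le (S * B);
    rewrite (le_trans ler01 SB1); lra.
exists l, L; split.
- by rewrite -(ltr_nat R); have := truncnS_gt (expR B); have := cube_le_expR B0;
    have := expR_ge1Dx B; rewrite -/L; have [->|] := posnP L;
      rewrite ?ltr0n//; lra.
- apply: (@le_trans _ _ (expR B)); first by rewrite truncn_le expR_ge0.
  rewrite /y -expRM_natl ler_expR ler_pdivlMr// mulrC.
  by rewrite (le_trans (ltW (truncnS_gt _))).
move=> x hx hL.
pose th := two_levels r y k.
pose t0 := k%:R * f r + l%:R * f y.
have thE : \sum_(j < k + l) f (th j) = t0.
  rewrite big_split_ord /=; congr (_ + _).
    rewrite (eq_bigr (fun=> f r)) => [|j _]; last by rewrite /th /two_levels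
      ltn_ord.
    by rewrite sumr_const card_ord mulr_natl.
  rewrite (eq_bigr (fun=> f y)) => [|j _].
    by rewrite sumr_const card_ord mulr_natl.
  by rewrite /th /two_levels -[X in (_ < X)%N]addn0 ltn_add2l.
have t00 : 0 <= t0 by rewrite addr_ge0// mulr_ge0// ltW.
have gap := expR_inv_gap S0.
have lam0 := regular_malthusian_gt0 hf.
have t0le : t0 <= 6 * S ^+ 2 * f r + 2 * (S * B) * (c3 * f 1).
  by rewrite lerD// ler_pM// ltW.
(* The window length [kappa * f 1] is at most [f (exp (- 1 / S))], so every birth in a window still
   has discounted weight of order [1 / S] at its end. *)
have h0 : 0 < kappa * f 1 by rewrite mulr_gt0.
have := @freezing_time_le R f (regular_ge0 hf) x S t0 (kappa * f 1)
  (expR (- C) * (1 - expR (- S^-1))) (generation x th (k + l))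
  (uniq_generation _ _ _) h0 t00.
move=> hT; apply: (le_trans (hT _ _ _ (ltW S0))).
- move=> v /(birth_time_generation hx (regular_nondecreasing hf)).
  by rewrite thE.
- move=> a a0 ah.
  apply: (discounted_weight_ge (regular_nondecreasing hf)) => //.
  + exact: ltW.
  + exact: regular_malthusian_le hf.
  + by rewrite (le_trans ah)//; exact: regular_low hf.
  + by rewrite expR_le1 oppr_le0 invr_ge0 ltW.
- have t0h : t0 / (kappa * f 1) + 1 <= c4 * (S ^+ 2 * B).
    have S2B : 1 <= S ^+ 2 * B by rewrite expr2 -mulrA -[1]mulr1 ler_pM.
    have : t0 / (kappa * f 1) <= (6 + 2 * c3) * c3 * (S ^+ 2 * B).
      rewrite ler_pdivrMr// (le_trans t0le)// frE.
      have e1 : (6 + 2 * c3) * c3 * (S ^+ 2 * B) * (kappa * f 1) =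
          (6 + 2 * c3) * (S ^+ 2 * B) * f 1 by rewrite /c3; field;
            rewrite gt_eqF.
      rewrite e1.
      have i1 : 6 * S ^+ 2 * (A * f 1) <= 6 * S ^+ 2 * (B * f 1).
        by rewrite ler_wpM2l ?mulr_ge0 ?exprn_ge0 ?(ltW S0)// ler_pM2r// /B;
          lra.
      have i2 : S * B <= S ^+ 2 * B by rewrite ler_wpM2r// expr2 ler_peMl// ltW.
      have i3 : 2 * (S * B) * (c3 * f 1) <= 2 * (S ^+ 2 * B) * (c3 * f 1).
        by rewrite ler_pM2r ?mulr_gt0//; lra.
      lra.
    rewrite /c4; lra.
  (* The window count gives [S ^ 2 * B], the threshold and the inverse weight one factor [S] each,
     and a fifth absorbs the constants; as [S <= B], the product is at most [B ^ 6]. *)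
  have eB : B * S ^+ 5 <= q * expR B.
    rewrite (le_trans _ (hq _ B0))// [B ^+ 6]exprS ler_wpM2l//.
    by rewrite lerXn2r ?nnegrE// ?(ltW S0)// /B; lra.
  have sz : expR B <= (size (generation x th (k + l)))%:R.
    by rewrite (le_trans (ltW (truncnS_gt _)))// ler_nat.
  apply: (@le_trans _ _ (c4 * (S ^+ 2 * B) * S)); first by rewrite ler_pM2r.
  apply: (@le_trans _ _ (expR B * (expR (- C) * (S + 1)^-1))); last first.
    apply: ler_pM => //.
      by rewrite mulr_ge0 ?expR_ge0// invr_ge0; lra.
    by rewrite ler_pM2l ?expR_gt0.
  rewrite mulrA ler_pdivlMr; last lra.
  rewrite expRN ler_pdivlMr//.
  have j1 : c4 * (S ^+ 2 * B) * S * (S + 1) * expR C <= 2 * (c4 * expR C) * (S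
    ^+ 4 * B).
    have -> : c4 * (S ^+ 2 * B) * S * (S + 1) * expR C =
      (c4 * expR C) * (S ^+ 3 * B) * (S + 1) by ring.
    have -> : 2 * (c4 * expR C) * (S ^+ 4 * B) =
      (c4 * expR C) * (S ^+ 3 * B) * (2 * S) by ring.
    rewrite ler_wpM2l ?mulr_ge0 ?exprn_ge0 ?(ltW S0) ?(ltW c40) ?expR_ge0//;
      lra.
  have j2 : 2 * q * (c4 * expR C) * (S ^+ 4 * B) <= S * (S ^+ 4 * B).
    by rewrite ler_wpM2r// mulr_ge0 ?exprn_ge0 ?(ltW S0).
  have j3 : S * (S ^+ 4 * B) = B * S ^+ 5 by ring.
  rewrite (le_trans j1)// -(ler_pM2l q0) (le_trans _ eB)//
    -j3 (le_trans _ j2)//.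
  by rewrite le_eqVlt; apply/orP; left; apply/eqP; ring.
rewrite lee_fin.
have r2 : r <= r + delta by lra.
rewrite (le_trans _ (regular_growth hf (ltW r1) r2))//.
apply: (@le_trans _ _ (f r * (c5 * S ^+ 2))); last by rewrite ler_pM2l// hK1.
have m1 : B * f 1 <= 2 * S * f r.
  have : S * f 1 <= S * f r by rewrite ler_pM2l.
  have : f r <= S * f r by rewrite ler_peMl// ltW.
  rewrite /B mulrDl -frE; lra.
have m2 : 2 * (S * B) * (c3 * f 1) <= 4 * c3 * (S ^+ 2 * f r).
  have : 2 * c3 * S * (B * f 1) <= 2 * c3 * S * (2 * S * f r).
    by rewrite ler_wpM2l// !mulr_ge0//; lra.
  lra.
have m3 : kappa * f 1 <= S ^+ 2 * f r.
  apply: (@le_trans _ _ (1 * f r)); first by rewrite ler_pM// ltW.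
  by rewrite ler_pM2r// -[1]mulr1 expr2 ler_pM.
rewrite /c5; lra.
Qed.

End deterministic_bounds.

(** * Regularity of the edge weights *)

Section asymptotic_regularity.
Context {R : realType}.

(** The gap [delta] makes [f r < f (r + delta)], so all births up to time [f r] lie in the extinct
    tree. [Num.max r 1] appears because [discounted_weight_le] concerns levels at least 1. *)
Lemma freezing_time_lower (f : R -> R) (S eps kappa C r delta : R) x K :
  regular_weight f S eps kappa C -> 1 <= eps * S -> 0 < r -> 0 < delta ->
  locally_finite x -> size (generation x (fun _ => r + delta) K) = 0%N ->
  (\sum_(i < K) size (generation x (fun _ => (r + delta)%R) i))%:R *
    (2 * Num.max r 1 + 4 / ln 2) < S ->
  ((f r)%:E <= freezing_time f S x)%E.
Proof.
move=> hf eS r0 d0 hx K0 hS.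
have ln2_gt0 : 0 < ln 2 :> R by rewrite ln_gt0// ltr1n.
have m1 : 1 <= Num.max r 1 by rewrite le_max lexx orbT.
have N0 : (0 < Num.truncn (eps * S))%N by rewrite truncn_gt0.
apply: (@freezing_time_ge _ _ _ _ _ (2 * Num.max r 1 + 4 / ln 2)
  (flatten [seq generation x (fun _ => r + delta) i | i <- index_iota 0 K])).
- by rewrite addr_ge0 ?divr_ge0 ?mulr_ge0// ltW//; lra.
- by rewrite size_flatten /shape -map_comp sumnE big_map big_mkord.
move=> t v tr vt; split.
  have vg : v \in generation x (fun _ => r + delta) (size v).
    apply: (branching_process_generation hx (regular_ge0 hf)
      (regular_nondecreasing hf) _ vt).
    by rewrite (le_lt_trans tr)//; apply: (regular_increasing hf) => //; lra.
  apply/flattenP; exists (generation x (fun _ => r + delta) (size v)) => //.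
  apply/mapP; exists (size v) => //; rewrite mem_index_iota /= ltnNge.
  by apply/negP => /generation_nil /(_ K0) /size0nil h; rewrite h in vg.
apply: (discounted_weight_le (regular_ge0 hf) (regular_nondecreasing hf) N0
  (regular_growth hf)) => //.
- exact: regular_malthusian_gt0 hf.
- exact: regular_malthusian_ge hf.
- have b0 : 0 <= birth_time f x v by exact: birth_time_ge0 (regular_ge0 hf).
  have : f r <= f (Num.max r 1).
    by apply: (regular_nondecreasing hf); rewrite le_max lexx.
  lra.
Qed.

(** The right limit at 0 is the infimum over []0, 1[], hence nonnegative and below all values at
    positive points; this makes the extension to [z <= 0] monotone. *)
Lemma edge_fun_nondecreasing (g : nat -> R -> R) n : (0 < n)%N ->
  positive_increasing (g n) ->
  [/\ forall z, 0 <= edge_fun g n z, forall z, 0 < z -> 0 < edge_fun g n z,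
    {homo edge_fun g n : a b / a <= b} &
    forall y z, 0 < y -> y < z -> edge_fun g n y < edge_fun g n z].
Proof.
move=> n0 [gpos ginc]; have n0' : 0 < n%:R :> R by rewrite ltr0n.
pose h y := g n (y / n%:R).
have hpos y : 0 < y -> 0 < h y by move=> y0; apply: gpos; rewrite divr_gt0.
have hinc y z : 0 < y -> y < z -> h y < h z.
  by move=> y0 yz; apply: ginc; rewrite ?divr_gt0// ltr_pM2r// invr_gt0.
have [L Llim [L0 Lh]] : exists2 L, lim (h y @[y --> 0^'+]) = L &
    0 <= L /\ forall y, 0 < y -> L <= h y.
  have hl : has_lbound (h @` `]0, 1[%classic).
    by exists 0 => _ [y /= + <-]; rewrite in_itv/= => /andP[y0 _];
      exact/ltW/hpos.
  have cvgh := @nondecreasing_at_right_cvgr R h 0 (BLeft 1) _ _ hl.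
  exists (inf (h @` `]0, 1[%classic)).
    apply: cvg_lim => //; apply: cvgh; first by rewrite bnd_simp.
    move=> y z; rewrite !in_itv/= => /andP[y0 _] /andP[z0 _].
    by rewrite le_eqVlt => /orP[/eqP ->//|/(hinc _ _ y0)/ltW].
  have half : `]0, 1[%classic (2^-1 : R) by rewrite /= in_itv/=; apply/andP;
    split; lra.
  split.
    apply: lb_le_inf; first by exists (h 2^-1); exists 2^-1.
    by move=> _ [y /= + <-]; rewrite in_itv/= => /andP[y0 _]; exact/ltW/hpos.
  move=> y y0; have [y1|y1] := ltP y 1.
    by apply: ge_inf => //; exists y => //=; rewrite in_itv/= y0.
  apply: (@le_trans _ _ (h 2^-1)); last by apply/ltW/hinc; lra.
  by apply: ge_inf => //; exists 2^-1.
have fE y : 0 < y -> edge_fun g n y = h y by rewrite /edge_fun => ->.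
have fE0 y : y <= 0 -> edge_fun g n y = L by rewrite /edge_fun ltNge => ->.
split.
- by move=> z; have [/fE0 ->//|z0] := leP z 0; rewrite fE// ltW// hpos.
- by move=> z z0; rewrite fE// hpos.
- move=> a b; rewrite le_eqVlt => /orP[/eqP ->//|ab].
  have [a0|a0] := leP a 0.
    by rewrite (fE0 a a0); have [/fE0 ->//|b0] := leP b 0; rewrite fE// Lh.
  have b0 := lt_trans a0 ab.
  by rewrite (fE a a0) (fE b b0); exact/ltW/hinc.
- by move=> y z y0 yz; rewrite (fE y y0) (fE z (lt_trans y0 yz)); exact: hinc.
Qed.

(** [ln (f u) - e * ln u] has nonnegative derivative beyond 1; its increment from [y] to [z] is
    exponentiated. *)
Lemma logarithmic_growth (f : R -> R) (e : R) (N : nat) :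
  (forall z, 0 < z -> 0 < f z) -> N%:R <= e ->
  (forall z, 1 <= z -> derivable (fun y => ln (f y)) z 1 /\
     e <= z * derive1 (fun y => ln (f y)) z) ->
  forall y z, 1 <= y -> y <= z -> f y * (z / y) ^+ N <= f z.
Proof.
move=> f0 Ne df y z y1 yz.
have y0 : 0 < y by lra.
have z0 : 0 < z by lra.
pose h u := ln (f u) - e * ln u.
have dh (u : R) : 1 <= u -> is_derive u (1 : R) h (derive1 (fun y =>
  ln (f y)) u - e * u^-1).
  move=> u1; have u0 : 0 < u by lra.
  have [d1 _] := df u u1.
  have d2 : is_derive u (1 : R) (fun y => ln (f y)) (derive1 (fun y =>
    ln (f y)) u).
    by rewrite derive1E; exact: derivableP.
  have d3 : is_derive u (1 : R) (e \*: (@ln R)) (e *: u^-1).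
    by apply: is_deriveZ; exact: is_derive1_ln.
  exact: is_deriveB.
have hyz : h y <= h z.
  apply: (@ger0_derive1_ndecr _ h y z) => //.
  - move=> u; rewrite in_itv/= => /andP[yu _].
    by have [] := dh u (le_trans y1 (ltW yu)).
  - move=> u; rewrite in_itv/= => /andP[yu _].
    have u1 : 1 <= u by lra.
    have u0 : 0 < u by lra.
    rewrite derive1E; have [_ ->] := dh u u1.
    by rewrite subr_ge0 ler_pdivrMr// mulrC; exact: (df u u1).2.
  - apply: derivable_within_continuous => u; rewrite in_itv/= => /andP[yu _].
    by have [] := dh u (le_trans y1 yu).
have zy : 1 <= z / y by rewrite ler_pdivlMr// mul1r.
have zy0 : 0 < z / y by lra.
have lzy : ln (z / y) = ln z - ln y by rewrite ln_div.
have : N%:R * ln (z / y) <= ln (f z) - ln (f y).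
  apply: (@le_trans _ _ (e * ln (z / y))); first by rewrite ler_wpM2r// ln_ge0.
  by move: hyz; rewrite /h lzy; lra.
rewrite -ler_expR expRM_natl lnK ?posrE// expRB !lnK ?posrE ?f0//.
by rewrite ler_pdivlMr ?f0// mulrC.
Qed.

Lemma eventually_regular (g : nat -> R -> R) (s : nat -> R) (eps : R) (n1 : nat)
    (f := edge_fun g) :
  (forall n, (0 < n)%N -> positive_increasing (g n)) ->
  s n @[n --> \oo] --> +oo ->
  (forall x : R, 0 <= x -> f n (x `^ (s n)^-1) / f n 1 @[n --> \oo] --> x) ->
  0 < eps ->
  (forall (n : nat) (x : R), (n1 <= n)%N -> 1 <= x ->
     derivable (fun y => ln (f n y)) x 1 /\
     eps * s n <= x * derive1 (fun y => ln (f n y)) x) ->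
  exists kappa C : R, [/\ 0 < kappa, kappa <= 1 &
    \forall n \near \oo, regular_weight (f n) (s n) eps kappa C].
Proof.
move=> hg s_infty cond1 eps0 cond3.
have e1 : 2 <= expR 1 :> R by have := expR_ge1Dx (1 : R).
have em1 : 0 < expR (-1) :> R by exact: expR_gt0.
have em2 : expR (-1) <= 2^-1 :> R by rewrite expRN lef_pV2 ?posrE// ?expR_gt0.
(* [cond1] at [exp (- 1)] and [exp 1] controls the ratios at [exp (- 1 / s n)] and [exp (1 / s n)];
   the factor 2 separates [kappa] and [kappa^-1] from the two limits. *)
pose kappa := expR (-1) / 2 : R.
have kap0 : 0 < kappa by rewrite divr_gt0.
have kap1 : kappa <= 1 by rewrite /kappa; lra.
(* The first term makes [exp (- (C * kappa)) <= 1 / 2], the second makes the tail beyond 1 in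
   [laplace_le] smaller than [1 / (4 * S)]. *)
pose C := kappa^-1 + 16 / eps.
have C1 : kappa^-1 <= C by rewrite /C lerDl divr_ge0// ltW.
have C2 : 16 / eps <= C by rewrite /C lerDr invr_ge0 ltW.
have kapi : 1 <= kappa^-1 by rewrite invf_ge1.
have C0 : 0 < C by lra.
exists kappa, C; split=> //.
have low : \forall n \near \oo, kappa < f n (expR (- (s n)^-1)) / f n 1.
  have := cond1 _ (expR_ge0 (-1)).
  move=> /cvgr_gt /(_ kappa); rewrite {1}/kappa ltr_pdivrMr//.
  rewrite ltr_pMr// ltr1n => /(_ isT); apply: filterS => n.
  by rewrite /powR gt_eqF// expRK mulrN1.
have high : \forall n \near \oo, f n (expR (s n)^-1) / f n 1 < kappa^-1.
  have := cond1 _ (expR_ge0 1).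
  move=> /cvgr_lt /(_ kappa^-1); rewrite {1}/kappa invf_div expRN invrK.
  rewrite ltr_pMl ?expR_gt0// ltr1n => /(_ isT); apply: filterS => n.
  by rewrite /powR gt_eqF ?expR_gt0// expRK mulr1.
have large : \forall n \near \oo, 1 + 2 / eps <= s n.
  by move/cvgryPge : s_infty; exact.
near=> n.
have n0 : (0 < n)%N by near: n; exact: nbhs_infty_gt.
have S1 : 1 + 2 / eps <= s n by near: n.
have hlow : kappa < f n (expR (- (s n)^-1)) / f n 1 by near: n; exact: low.
have hhigh : f n (expR (s n)^-1) / f n 1 < kappa^-1 by near: n; exact: high.
have nn1 : (n1 <= n)%N by near: n; exact: nbhs_infty_ge.
have q0 : 0 < 2 / eps by rewrite divr_gt0.
set S := s n in S1 hlow hhigh *; have S0 : 0 < S by lra.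
have eS : 2 <= eps * S by rewrite mulrC -ler_pdivrMr//; lra.
have [f_ge0 f_gt0 ndf f_inc] := edge_fun_nondecreasing n0 (hg n n0).
have f1 : 0 < f n 1 by exact: f_gt0.
have growth : forall y z, 1 <= y -> y <= z ->
    f n y * (z / y) ^+ Num.truncn (eps * S) <= f n z.
  apply: (logarithmic_growth (e := eps * S)) => //.
    by rewrite truncn_le; lra.
  move=> z z1; exact: cond3.
have N0 : (0 < Num.truncn (eps * S))%N by rewrite truncn_gt0; lra.
have flow : kappa * f n 1 <= f n (expR (- S^-1)).
  by rewrite -ler_pdivlMr// ltW.
have fhigh : kappa * f n (expR S^-1) <= f n 1.
  move: hhigh; rewrite ltr_pdivrMr// => /ltW/(ler_wpM2l (ltW kap0)).
  by rewrite mulrA divff ?gt_eqF// mul1r.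
(* With [p = exp (- 1 / S)] the bound is 1 minus [(1 - p) * (1 - exp (- (C * kappa)))] plus the
   tail. Both corrections are of order [1 / S], and the gain is at least [1 / (4 * S)]. *)
have LC : (laplace (f n) (C / f n 1)%R < 1)%E.
  have p0 : 0 <= expR (- S^-1) by exact: expR_ge0.
  have p1 : expR (- S^-1) <= 1 by rewrite expR_le1 oppr_le0 invr_ge0 ltW.
  have l0 : 0 < C / f n 1 by rewrite divr_gt0.
  rewrite (le_lt_trans (laplace_le f_ge0 ndf f1 N0 growth l0 p0 p1 flow))//.
  rewrite divfK ?gt_eqF// lte_fin.
  have gap := expR_inv_gap S0.
  have i1 : expR (- (C * kappa)) <= 2^-1.
    rewrite (le_trans _ em2)// ler_expR lerN2 -ler_pdivrMr//; lra.
  have i2 : expR (- C) <= C^-1.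
    by rewrite expRN lef_pV2 ?posrE ?expR_gt0//; have := expR_ge1Dx C; lra.
  have i3 : (2 * S)^-1 <= 1 - expR (- S^-1).
    by rewrite (le_trans _ gap)// lef_pV2 ?posrE//; lra.
  have hN : eps * S / 2 <= (Num.truncn (eps * S))%:R.
    by have := truncnS_gt (eps * S); rewrite -natr1; lra.
  have Npos : 0 < (Num.truncn (eps * S))%:R :> R by rewrite ltr0n.
  have i4 : expR (- C) / (C * (Num.truncn (eps * S))%:R) < (4 * S)^-1.
    have CC : 8 < C * C * eps.
      have h : 16 <= C * eps by rewrite -ler_pdivrMr.
      have : C * 16 <= C * (C * eps) by rewrite ler_pM2l.
      lra.
    have h1 : C^-1 / (C * (eps * S / 2)) < (4 * S)^-1.
      rewrite (_ : C^-1 / (C * (eps * S / 2)) = (C * C * eps * S / 2)^-1);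
        last first.
        by field; rewrite !gt_eqF.
      rewrite ltf_pV2 ?posrE ?mulr_gt0//.
      have : 8 * S < C * C * eps * S by rewrite ltr_pM2r.
      lra.
    apply: le_lt_trans h1; apply: ler_pM => //;
      first by rewrite invr_ge0 mulr_ge0// ltW.
    rewrite lef_pV2 ?posrE; first by rewrite ler_pM2l.
      by rewrite mulr_gt0.
    by rewrite mulr_gt0//; lra.
  have i5 : (2 * S)^-1 * 2^-1 <= (1 - expR (- S^-1)) * (1 - expR (- (C *
    kappa))).
    by apply: ler_pM; rewrite ?invr_ge0//; lra.
  have i6 : (2 * S)^-1 * 2^-1 = (4 * S)^-1 by field; lra.
  lra.
have [m1 m2 m3] := malthusianP f_ge0 f_gt0 ndf f1 N0 growth C0 LC.
exact: RegularWeight.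
Unshelve. all: by end_near. Qed.

End asymptotic_regularity.

(** * Convergence in probability *)

Section outer_probability.
Context d (T : measurableType d) (R : realType) (P : probability T R).
Local Open Scope ereal_scope.

(** For events about [M] and the freezing time, not known to be measurable: an event containing them
    almost surely bounds their outer measure. *)
Lemma outer_le_ae (A B : set T) (e : \bar R) : measurable B -> P B <= e ->
  {ae P, forall w, A w -> B w} -> (P^*)%mu A <= e.
Proof.
move=> mB PB [N [mN N0 hN]].
have mBN : measurable (B `|` N) by exact: measurableU.
rewrite (le_trans _ PB)//.
apply: (@le_trans _ _ ((P^*)%mu (B `|` N))).
  apply: le_mu_ext => w Aw; have [Bw|nBw] := pselect (B w); first by left.
  by right; apply: hN => /= /(_ Aw).
rewrite measurable_mu_extE//.
apply: (le_trans (measureU2 P mB mN)).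
by rewrite [X in _ + X](_ : _ = 0) ?adde0.
Qed.

Lemma cvge0_le (u : nat -> \bar R) : (forall n, 0 <= u n) ->
  (forall e : R, (0 < e)%R -> \forall n \near \oo, u n <= e%:E) ->
  u n @[n --> \oo] --> 0.
Proof.
move=> u0 ue; apply/fine_cvgP; split.
  apply: filterS (ue 1%R ltr01) => n un.
  by rewrite ge0_fin_numE// (le_lt_trans un)// ltry.
apply/cvgrPdist_le => e e0; apply: filterS (ue e e0) => n un.
rewrite /= sub0r normrN ger0_norm ?fine_ge0//.
by rewrite -lee_fin fineK// ge0_fin_numE// (le_lt_trans un)// ltry.
Qed.

End outer_probability.

Section convergence.
Context {R : realType} {d : measure_display} {Omega : measurableType d}.
Context (P : probability Omega R) (X : vertex -> {RV P >-> R}).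
Context (g : nat -> R -> R) (s : nat -> R).
Hypothesis hX : is_PWIT X.
Let f := edge_fun g.
Hypotheses (hg : forall n, (0 < n)%N -> positive_increasing (g n))
  (s_infty : s n @[n --> \oo] --> +oo)
  (cond1 : forall x : R, 0 <= x ->
    f n (x `^ (s n)^-1) / f n 1 @[n --> \oo] --> x)
  (cond3 : exists (eps1 : R) (n1 : nat),
    0 < eps1 /\
      forall (n : nat) (x : R), (n1 <= n)%N -> 1 <= x ->
        derivable (fun y => ln (f n y)) x 1 /\
        eps1 * s n <= x * derive1 (fun y => ln (f n y)) x).

Let Y n w := edge_fun_inv (f n) (freezing_time (f n) (s n) (fun v => X v w)).
Let M w := max_invaded_weight (fun v => X v w).

Let s_large (K : R) : \forall n \near \oo, K <= s n.
Proof. by move/cvgryPge : s_infty; exact. Qed.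

(** [M < r] forces generation [k] to be nonempty, and by [freezing_time_upper] late freezing forces
    generation [k + l] to have at most [L] vertices; [two_stage_probability] bounds the
    conjunction. *)
Lemma freezing_above (r delta e : R) : 1 < r -> 0 < delta -> 0 < e ->
  \forall n \near \oo, ((P^*)%mu [set w | (M w < r%:E)%E /\
    ((r + delta)%:E < Y n w)%E] <= e%:E)%E.
Proof.
move=> r1 d0 e0; have [eps [n1 [eps0 c3]]] := cond3.
have [kappa [C [kap0 kap1 reg]]] := eventually_regular hg s_infty cond1 eps0 c3.
have [K0 hK0] := freezing_time_upper C r1 d0 eps0 kap0 kap1.
have [N0 hN0] := two_stage_probability hX r1 e0.
near=> n.
have hn : regular_weight (f n) (s n) eps kappa C by near: n; exact: reg.
have sK0 : K0 <= s n by near: n; exact: s_large.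
have sN0 : N0%:R <= s n by near: n; exact: s_large.
have s1 : 1 <= s n by near: n; exact: s_large.
have s0 : 0 < s n by lra.
have [l [L [L0 Ly hL]]] := hK0 (f n) (s n) sK0 hn.
set N := (Num.truncn (s n)).+1 in hL; set k := (N * N + N)%N in hL.
set y := expR (s n)^-1 in Ly hL; set th := two_levels r y k in hL.
have NN0 : (N0 <= N)%N.
  by rewrite -(ler_nat R) (le_trans sN0)// ltW// truncnS_gt.
have y1 : 1 < y by rewrite expR_gt1 invr_gt0.
have := hN0 N l L y NN0 y1 (critical_level_le s0) L0 Ly.
rewrite -/k -/th => PB; apply: outer_le_ae PB _.
  apply: measurableI.
    exact: (measurable_size_generation X th k (fun m => 0 < m)%N).
  exact: (measurable_size_generation X th (k + l) (fun m => m <= L)%N).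
apply: filterS (ae_locally_finite hX) => w hw [Mr Yr]; split.
  rewrite (@eq_generation _ _ _ (fun _ => r)).
    exact: max_invaded_weight_lt hw _ Mr k.
  by move=> i ik; rewrite /th /two_levels ik.
rewrite leqNgt; apply/negP => /(hL _ hw) hT; move: Yr; rewrite ltNge => /negP;
  apply.
apply: (edge_fun_inv_le (regular_increasing hn)) => //; lra.
Unshelve. all: by end_near. Qed.

(** The tree at level [r + delta] is extinct. A total size below [m], with [m] fixed before [n],
    would keep the freezing time at least [f r] for large [s n], and a size of at least [m] is
    unlikely. *)
Lemma freezing_below (r delta e : R) : 0 < r -> 0 < delta -> 0 < e ->
  \forall n \near \oo, ((P^*)%mu [set w | ((r + delta)%:E < M w)%E /\
    (Y n w < r%:E)%E] <= e%:E)%E.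
Proof.
move=> r0 d0 e0; have [eps [n1 [eps0 c3]]] := cond3.
have [kappa [C [kap0 kap1 reg]]] := eventually_regular hg s_infty cond1 eps0 c3.
have [m [mB PB]] := extinct_size_tight X (fun _ => r + delta) e0.
have ln2_gt0 : 0 < ln 2 :> R by rewrite ln_gt0// ltr1n.
pose c : R := 2 * Num.max r 1 + 4 / ln 2.
have m1 : 1 <= Num.max r 1 by rewrite le_max lexx orbT.
have c0 : 0 <= c by rewrite addr_ge0 ?divr_ge0// ?(ltW ln2_gt0)// mulr_ge0//;
  lra.
near=> n.
have hn : regular_weight (f n) (s n) eps kappa C by near: n; exact: reg.
have s1 : eps^-1 <= s n by near: n; exact: s_large.
have sm : m%:R * c + 1 <= s n by near: n; exact: s_large.
apply: (outer_le_ae mB PB).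
apply: filterS (ae_locally_finite hX) => w hw [Mr Yr].
have [k k0] := max_invaded_weight_gt hw Mr.
exists k; split=> //; rewrite leqNgt; apply/negP => hm.
move: Yr; rewrite ltNge => /negP; apply.
apply: edge_fun_inv_ge => //.
apply: (freezing_time_lower hn _ r0 d0 hw k0).
  by rewrite mulrC -ler_pdivrMr// mul1r.
rewrite -/c (le_lt_trans (ler_wpM2r c0 (_ : _ <= m%:R)))//; last lra.
by rewrite ler_nat ltnW.
Unshelve. all: by end_near. Qed.

(** [M < 1] would keep every generation of the critical tree nonempty. This lets the grid start at
    1. *)
Lemma max_invaded_weight_lt1 (e : R) : 0 < e ->
  ((P^*)%mu [set w | (M w < 1)%E] <= e%:E)%E.
Proof.
move=> e0; have [k hk] := probability_critical_survival hX e0.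
apply: outer_le_ae hk _.
  exact: (measurable_size_generation X _ k (fun m => 0 < m)%N).
apply: filterS (ae_locally_finite hX) => w hw Mr.
exact: max_invaded_weight_lt hw _ Mr k.
Qed.

Lemma max_invaded_weight_tail (r e : R) : 1 < r -> r^-1 <= e ->
  ((P^*)%mu [set w | (r%:E < M w)%E] <= e%:E)%E.
Proof.
move=> r1 re; have hE := probability_extinction hX r1.
apply: outer_le_ae (le_trans hE _) _.
- rewrite (_ : [set w | _] = \bigcup_k [set w | size (generation (X^~ w) (fun _
  => r) k) = 0%N]).
    apply: bigcupT_measurable => k.
    exact: (measurable_size_generation X _ k [set 0%N]).
  by apply/seteqP; split=> w [k]; [exists k|exists k].
- by rewrite lee_fin.
apply: filterS (ae_locally_finite hX) => w hw; exact: max_invaded_weight_gt.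
Qed.

Lemma max_invaded_weight_cvg : cvg_in_probability P Y M.
Proof.
move=> eps eps0; apply: cvge0_le => [n|e e0]; first exact: mu_ext_ge0.
pose delta := eps / 4; have d0 : 0 < delta by rewrite divr_gt0.
have epsE : eps = 4 * delta by rewrite /delta; field.
(* Chosen so that [K * delta / 2 >= 4 / e]: then [M] exceeds [1 + K * delta / 2] with probability at
   most [e / 4], and the cells of index below [K] cover the rest. *)
pose K := (Num.truncn (2 * (4 / e) / delta)).+1.
have e4 : 0 < e / 4 by rewrite divr_gt0.
have K0 : 0 < K%:R :> R by rewrite ltr0n.
pose eK := e / 4 / K%:R; have eK0 : 0 < eK by rewrite divr_gt0.
(* For [M] in the cell from [1 + i * delta] to [1 + i.+1 * delta], a [Y] above [M + 4 * delta] lands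
   in [above n i], and a [Y] below [M - 4 * delta] in [below n i], whose level is
   [1 + (i - 2) * delta]. *)
pose above n (i : nat) : set Omega := [set w | (M w < (1 + i.+1%:R *
  delta)%:E)%E /\
  ((1 + i.+1%:R * delta + delta)%:E < Y n w)%E].
pose below n (i : nat) : set Omega :=
  [set w | [/\ 0 < 1 + i%:R * delta - 2 * delta,
    ((1 + i%:R * delta - 2 * delta + delta)%:E < M w)%E &
    (Y n w < (1 + i%:R * delta - 2 * delta)%:E)%E]].
have nabove : \forall n \near \oo, forall i : 'I_K, ((P^*)%mu (above n i) <=
  eK%:E)%E.
  apply: filter_forall => i; apply: freezing_above => //.
  by rewrite ltrDl mulr_gt0// ltr0n.
have nbelow : \forall n \near \oo, forall i : 'I_K, ((P^*)%mu (below n i) <=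
  eK%:E)%E.
  apply: filter_forall => i.
  (* When the level is not positive, the first clause of [below] makes the event empty; nothing is
     lost, as [Y] is nonnegative. *)
  have [ri|ri] := ltP 0 (1 + i%:R * delta - 2 * delta).
    apply: filterS (freezing_below ri d0 eK0) => n; apply: le_trans.
    by apply: le_mu_ext => w [].
  apply: nearW => n; rewrite (_ : below n i = set0).
    by rewrite outer_measure0 lee_fin ltW.
  by apply/seteqP; split=> w // []; rewrite ltNge ri.
have sumK (F : 'I_K -> set Omega) : (forall i, ((P^*)%mu (F i) <= eK%:E)%E) ->
    ((P^*)%mu (\big[setU/set0]_(i < K) F i) <= (e / 4)%:E)%E.
  move=> hF; pose F' k := if insub k is Some i then F i else set0.
  have -> : \big[setU/set0]_(i < K) F i = \big[setU/set0]_(i < K) F' i.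
    by apply: eq_bigr => i _; rewrite /F' valK.
  rewrite (le_trans (outer_measure_subadditive _ _ _))//.
  apply: (@le_trans _ _ (\sum_(i < K) eK%:E)%E).
    by apply: lee_sum => i _; rewrite /F' valK; exact: hF.
  rewrite sumEFin sumr_const card_ord lee_fin -[_ *+ _]mulr_natr /eK divfK//.
  by rewrite gt_eqF.
near=> n.
have hA : forall i : 'I_K, ((P^*)%mu (above n i) <= eK%:E)%E by near: n.
have hB : forall i : 'I_K, ((P^*)%mu (below n i) <= eK%:E)%E by near: n.
have tail : ((P^*)%mu [set w | ((1 + K%:R * delta / 2)%:E < M w)%E] <= (e /
  4)%:E)%E.
  have Kd : 0 < K%:R * delta / 2 by rewrite !mulr_gt0.
  apply: max_invaded_weight_tail; first by rewrite ltrDl.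
  have Ke : 4 / e <= K%:R * delta / 2.
    rewrite ler_pdivlMr// mulrC -ler_pdivrMr//.
    by rewrite ltW// truncnS_gt.
  have e40 : 0 < 4 / e by rewrite divr_gt0.
  by rewrite -[leRHS]invrK lef_pV2 ?posrE ?invr_gt0// ?invf_div; lra.
have := max_invaded_weight_lt1 e4 => small.
have sub : [set w | (eps%:E < `|Y n w - M w|)%E] `<=`
   ([set w | (M w < 1)%E] `|` [set w | ((1 + K%:R * delta / 2)%:E < M w)%E]) `|`
   (\big[setU/set0]_(i < K) above n i `|` \big[setU/set0]_(i < K) below n i).
  move=> w /= hw; have Y0 : (0 <= Y n w)%E by exact: edge_fun_inv_ge0.
  have [M1|M1] := ltP (M w) 1%E; first by left; left.
  have [MK|MK] := ltP (1 + K%:R * delta / 2)%:E (M w); first by left; right.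
  right; rewrite -(bigcup_mkord K (above n)) -(bigcup_mkord K (below n));
    move: hw M1 MK.
  case ME : (M w) => [m||] //; rewrite !lee_fin => hw M1 MK.
  have q0 : 0 <= (m - 1) / delta by rewrite divr_ge0 ?subr_ge0// ltW.
  pose i := Num.truncn ((m - 1) / delta).
  have i1 : 1 + i%:R * delta <= m.
    by rewrite addrC -lerBrDr -ler_pdivlMr// truncn_le.
  have i2 : m < 1 + i.+1%:R * delta.
    by rewrite addrC -ltrBlDr -ltr_pdivrMr// truncnS_gt.
  have iK : (i < K)%N.
    rewrite -(ltr_nat R) -(ltr_pM2r d0).
    have : 0 < K%:R * delta by rewrite mulr_gt0.
    lra.
  have i3 : i.+1%:R * delta = i%:R * delta + delta by rewrite -natr1 mulrDl
    mul1r.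
  have [Ym|Ym] : (((m + eps)%:E < Y n w) \/ (Y n w < (m - eps)%:E))%E.
    move: hw Y0; case: (Y n w) => [y||] //; last by left; rewrite ltry.
    rewrite -EFinB /= !lte_fin !lee_fin => hw y0.
    have [ym|ym] := leP m y.
      by left; rewrite ger0_norm ?subr_ge0// in hw; lra.
    by right; rewrite ltr0_norm ?subr_lt0// in hw; lra.
  - left; exists i => //; rewrite /above /= ME lte_fin; split=> //.
    by apply: lt_trans Ym; rewrite lte_fin; lra.
  - right; exists i => //; rewrite /below /= ME lte_fin.
    have Yi : (Y n w < (1 + i%:R * delta - 2 * delta)%:E)%E.
      by apply: lt_trans Ym _; rewrite lte_fin; lra.
    split=> //; last lra.
    by rewrite -lte_fin; apply: le_lt_trans Yi.
(* Four contributions of [e / 4]: small [M], large [M], and the two unions over the grid. *)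
rewrite (le_trans (le_mu_ext _ sub))//.
have -> : e = (e / 4 + e / 4) + (e / 4 + e / 4) by field.
rewrite !EFinD.
rewrite (le_trans (outer_measureU2 _ _ _))//; apply: leeD.
  by rewrite (le_trans (outer_measureU2 _ _ _))//; apply: leeD.
by rewrite (le_trans (outer_measureU2 _ _ _))//; apply: leeD; exact: sumK.
Unshelve. all: by end_near. Qed.

End convergence.

Theorem theorem2p13 (R : realType) (d : measure_display)
    (Omega : measurableType d) (P : probability Omega R)
    (X : 'I_2 -> vertex -> {RV P >-> R}) (g : nat -> R -> R) (s : nat -> R)
    (f := edge_fun g)
    (hX : independent_PWITs X)
    (hg : forall n, (0 < n)%N -> positive_increasing (g n))
    (s_gt0 : forall n, (0 < n)%N -> 0 < s n)
    (s_infty : s n @[n --> \oo] --> +oo)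
    (cond1 : forall x : R, 0 <= x ->
      f n (x `^ (s n)^-1) / f n 1 @[n --> \oo] --> x)
    (cond2 : exists (eps0 delta0 : R) (n0 : nat),
      [/\ 0 < eps0, 0 < delta0, delta0 <= 1 &
        forall (n : nat) (x : R), (n0 <= n)%N -> 0 < x ->
          1 - delta0 <= x -> x <= 1 ->
          [/\ derivable (fun y => ln (f n y)) x 1,
              eps0 * s n <= x * derive1 (fun y => ln (f n y)) x &
              x * derive1 (fun y => ln (f n y)) x <= s n / eps0]])
    (cond3 : exists (eps1 : R) (n1 : nat),
      0 < eps1 /\
        forall (n : nat) (x : R), (n1 <= n)%N -> 1 <= x ->
          derivable (fun y => ln (f n y)) x 1 /\
          eps1 * s n <= x * derive1 (fun y => ln (f n y)) x) :
  forall j : 'I_2,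
    cvg_in_probability P
      (fun n w => edge_fun_inv (f n)
         (freezing_time (f n) (s n) (fun v => X j v w)))
      (fun w => max_invaded_weight (fun v => X j v w)).
Proof.
move=> j.
exact: (max_invaded_weight_cvg (hX.1 j) hg s_infty cond1 cond3).
Qed.
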